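(* Let $\mathcal R_{\mathbb K}[H]$ be the Hibi ring over a field $\mathbb K$ on a finite distributive lattice $H$, with irrelevant maximal ideal $\mathfrak m$ and canonical ideal $\omega$. Then the following hold. (1) The fiber cone $\bigoplus_{n\ge0}\omega^n/\mathfrak m\omega^n$ of the canonical ideal (resp. the fiber cone $\bigoplus_{n\ge0}(\omega^{(-1)})^n/\mathfrak m(\omega^{(-1)})^n$ of the anticanonical ideal) is $$\sum_{(y_0,x_1,\ldots,y_{t-1},x_t)\in N^{(1)}}R^{(1)}_{(y_0,x_1,\ldots,y_{t-1},x_t)}\qquad\Bigl(\text{resp. }\sum_{(y_0,x_1,\ldots,y_{t-1},x_t)\in N^{(-1)}}R^{(-1)}_{(y_0,x_1,\ldots,y_{t-1},x_t)}\Bigr),$$ where, for $\epsilon=1$ (resp. $\epsilon=-1$), each Ehrhart ring $R^{(\epsilon)}_{(y_0,\ldots,x_t)}$ is regarded as a graded $\mathbb K$-subalgebra of the fiber cone by sending the monomial of degree $n$ with exponent $\nu$ to the residue class of $T^\nu$ in $\omega^{(n\epsilon)}/\mathfrak m\omega^{(n\epsilon)}$ (the degree $n$ part of the fiber cone). (2) The canonical (resp. anticanonical) analytic spread, i.e. the Krull dimension of the fiber cone of $\omega$ (resp. of $\omega^{(-1)}$), is $$\max_{(y_0,\ldots,x_t)\in N^{(1)}}\dim C^{(1)}_{(y_0,x_1,\ldots,y_{t-1},x_t)}+1\qquad\Bigl(\text{resp. }\max_{(y_0,\ldots,x_t)\in N^{(-1)}}\dim C^{(-1)}_{(y_0,x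_1,\ldots,y_{t-1},x_t)}+1\Bigr).$$
   Context: **Hibi rings.** Let $x_0$ be the least element of $H$ and $P=\{\alpha\in H: \alpha=\beta\vee\gamma\Rightarrow\alpha=\beta\text{ or }\alpha=\gamma\}$ the poset of join-irreducible elements (so $x_0\in P$). With indeterminates $\{T_x\}_{x\in P}$, $\mathcal R_{\mathbb K}[H]=\mathbb K[\prod_{x\in I}T_x: I\text{ a nonempty down-closed subset of }P]$. With $\deg T_{x_0}=1$, $\deg T_x=0$ for $x\ne x_0$ it is a standard graded normal Cohen-Macaulay domain; $\mathfrak m$ is generated by the elements of positive degree. Let $P^+=P\cup\{\infty\}$ with $x<\infty$ for all $x\in P$, write $x\lessdot y$ if $y$ covers $x$, and $T^\nu=\prod_{x\in P}T_x^{\nu(x)}$. For $n\in\mathbb Z$ put $\mathcal T^{(n)}(P)=\{\nu:P^+\to\mathbb Z\mid\nu(\infty)=0,\ \nu(x)-\nu(y)\ge n\text{ if }x\lessdot y\text{ in }P^+\}$. The canonical ideal is $\omega=\bigoplus_{\nu\in\mathcal T^{(1)}(P)}\mathbb KT^\nu$; $\omega^{(n)}$ is its $n$-th power in the group $\mathrm{Div}(R)$ of divisorial fractional ideals of $R=\mathcal R_{\mathbb K}[H]$ (with product $I\cdot J=R:_{Q(R)}(R:_{Q(R)}IJ)$), and $\omega^{(-1)}$ is the anticanonical ideal. One has $\omega^n=\omega^{(n)}$ and $(\omega^{(-1)})^n=\omega^{(-n)}$ for $n>0$. **Quasi-distance.** For $x\le y$ in $P^+$ and $n\in\mathbb Z$,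 $q^{(n)}\mathrm{dist}(x,y)=\max\{nt\mid\text{there is a saturated chain }x=z_0\lessdot z_1\lessdot\cdots\lessdot z_t=y\}$. For $w_0<z_0>w_1<z_1>\cdots>w_\ell<z_\ell$ in $P^+$, $q^{(n)}(w_0,z_0,\ldots,w_\ell,z_\ell)=\sum_{i=0}^\ell q^{(n)}\mathrm{dist}(w_i,z_i)-\sum_{i=1}^\ell q^{(n)}\mathrm{dist}(w_i,z_{i-1})$. **Condition N and reducedness.** A (possibly empty, $t=0$) sequence $y_0,x_1,y_1,x_2,\ldots,y_{t-1},x_t$ of elements of $P\setminus\{x_0\}$ satisfies condition N if $y_0>x_1<y_1>x_2<\cdots<y_{t-1}>x_t$ and $y_i\not\ge x_j$ whenever $i\le j-2$. One always puts $x_0$ in front and sets $y_t=\infty$. It is $q^{(n)}$-reduced if $q^{(n)}\mathrm{dist}(x_i,y_j)<q^{(n)}(x_i,y_i,\ldots,x_j,y_j)$ for all $0\le i<j\le t$ with $x_i\le y_j$; the empty sequence is $q^{(n)}$-reduced. For $\epsilon=\pm1$, $N^{(\epsilon)}$ is the set of all $q^{(\epsilon)}$-reduced sequences with condition N. **Polytopes and Ehrhart rings.** For $(y_0,\ldots,x_t)\in N^{(\epsilon)}$, $C^{(\epsilon)}_{(y_0,x_1,\ldots,y_{t-1},x_t)}$ is the set of all $\nu:P^+\to\mathbb R$ with $\nu(\infty)=0$, $\nu(z)-\nu(z')\ge\epsilon$ whenever $z\lessdot z'$ in $P^+$, and $\nu(x_i)-\nu(y_i)=q^{(\epsilon)}\mathrm{dist}(x_i,y_i)$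 for $0\le i\le t$; it is regarded as a subset of $\mathbb R^P$ and is an integral convex polytope. $R^{(\epsilon)}_{(y_0,\ldots,x_t)}$ is the Ehrhart ring over $\mathbb K$ of $C=C^{(\epsilon)}_{(y_0,\ldots,x_t)}$, i.e. the $\mathbb K$-subalgebra of $\mathbb K[T_x^{\pm1}\mid x\in P][Y]$ generated by $\{T^\nu Y^n: n\in\mathbb N,\ \nu\in nC\cap\mathbb Z^P\}$, graded by the exponent of $Y$. *)

(* Defs.v *)
From HB Require Import structures.
From mathcomp Require Import all_boot all_order all_algebra.
From mathcomp Require Import boolp classical_sets reals.
From mathcomp Require Import mpoly.

Set Implicit Arguments.
Unset Strict Implicit.
Unset Printing Implicit Defensive.

Import Order.TTheory GRing.Theory Num.Theory.
Local Open Scope classical_set_scope.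
Local Open Scope ring_scope.
Local Open Scope quotient_scope.

Definition submod (L : comNzRingType) (A M : set L) : Prop :=
  [/\ M 0, forall u v, M u -> M v -> M (u - v)
    & forall a u, A a -> M u -> M (a * u)].

Definition modgen (L : comNzRingType) (A G : set L) : set L :=
  smallest (submod A) G.

Definition subalgebra (K L : comNzRingType) (iota : K -> L) (S : set L) : Prop :=
  [/\ forall c, S (iota c), forall u v, S u -> S v -> S (u - v)
    & forall u v, S u -> S v -> S (u * v)].

Definition alggen (K L : comNzRingType) (iota : K -> L) (G : set L) : set L :=
  smallest (subalgebra iota) G.

Definition sum_family (I : Type) (V : zmodType) (S : set I) (M : I -> set V) :
    set V :=
  [set f | exists n (s : 'I_n -> I) (g : 'I_n -> V),
     (forall k, S (s k) /\ M (s k) (g k)) /\ f = \sum_(k < n) g k].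

(* [idealr] (hence [prime_idealr]) requires ideals to be proper. *)
Definition prime_chain (A : comNzRingType) (n : nat)
    (p : 'I_n.+1 -> prime_idealr A) : Prop :=
  forall i j : 'I_n.+1, (i < j)%N ->
    {subset p i <= p j} /\ ~ {subset p j <= p i}.

Definition krull_dim (A : comNzRingType) (n : nat) : Prop :=
  (exists p : 'I_n.+1 -> prime_idealr A, prime_chain p) /\
  (forall m (p : 'I_m.+1 -> prime_idealr A), prime_chain p -> (m <= n)%N).

Definition is_max (D : set nat) (n : nat) : Prop :=
  D n /\ forall m, D m -> (m <= n)%N.

Section JoinIrreducible.
Variables (d : Order.disp_t) (H : finTBDistrLatticeType d).

Definition join_irr (a : H) : bool :=
  [forall b : H, forall c : H,
     (a == Order.join b c) ==> ((a == b) || (a == c))].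

Definition jirr : predArgType := {a : H | join_irr a}.

HB.instance Definition _ := SubFinite.on jirr.
HB.instance Definition _ := [SubChoice_isSubPOrder of jirr by <: with d].

Lemma join_irr_bot : join_irr \bot%O.
Proof.
apply/forallP => b; apply/forallP => c; apply/implyP.
by rewrite eq_sym join_eq0 => /andP[/eqP-> _]; rewrite eqxx.
Qed.

Definition x0 : jirr := exist _ \bot%O join_irr_bot.

Definition pplus : Type := option jirr.

HB.instance Definition _ := Finite.on pplus.

Definition pinf : pplus := None.

Definition pplus_le (x y : pplus) : bool :=
  match x, y with
  | _, None => true
  | None, Some _ => false
  | Some a, Some b => (a <= b)%O
  end.

Lemma pplus_le_refl : reflexive pplus_le.
Proof. by case=> //= a; apply: lexx. Qed.

Lemma pplus_le_anti : antisymmetric pplus_le.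
Proof. by case=> [a|] [b|] //= /le_anti ->. Qed.

Lemma pplus_le_trans : transitive pplus_le.
Proof. by case=> [a|] [b|] [c|] //=; apply: le_trans. Qed.

HB.instance Definition _ := Order.Le_isPOrder.Build d pplus
  pplus_le_refl pplus_le_anti pplus_le_trans.

Definition covered (x y : pplus) : bool :=
  (x < y)%O && [forall z : pplus, ~~ ((x < z)%O && (z < y)%O)].

(* A map P^+ -> V vanishing at infinity is encoded by its restriction to P. *)
Definition ext (V : zmodType) (nu : jirr -> V) (z : pplus) : V :=
  if z is Some x then nu x else 0.

Definition sat_chain (x y : pplus) (t : nat) : bool :=
  [exists z : t.-tuple pplus, path covered x z && (last x z == y)].

(* The elements of a chain are distinct, so its length is less than #|P^+|. *)
Definition chain_values (n : int) (x y : pplus) : seq int :=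
  [seq n * t%:Z | t <- iota 0 #|{: pplus}| & sat_chain x y t].

(* Used only for [x <= y]: otherwise there is no chain, and the value is 0. *)
Definition qdist (n : int) (x y : pplus) : int :=
  \big[Num.max/head 0 (chain_values n x y)]_(v <- chain_values n x y) v.

(* q^(n)(w_i, z_i, ..., w_j, z_j) *)
Definition qalt (n : int) (w z : nat -> pplus) (i j : nat) : int :=
  \sum_(i <= k < j.+1) qdist n (w k) (z k)
  - \sum_(i.+1 <= k < j.+1) qdist n (w k) (z k.-1).

(* The sequence y_0, x_1, ..., y_{t-1}, x_t is encoded by the list of pairs
   (y_0, x_1), ..., (y_{t-1}, x_t); [xs s i] and [ys s i] are x_i and y_i for
   0 <= i <= t, where x_0 is the least element and y_t is infinity. *)
Definition zseq : Type := seq (jirr * jirr).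

Definition xs (s : zseq) (i : nat) : pplus :=
  nth pinf (Some x0 :: [seq Some p.2 | p <- s]) i.

Definition ys (s : zseq) (i : nat) : pplus :=
  nth pinf [seq Some p.1 | p <- s] i.

Definition condN (s : zseq) : Prop :=
  [/\ forall p, p \in s -> p.1 != x0 /\ p.2 != x0,
      forall i, (i < size s)%N -> (xs s i.+1 < ys s i)%O,
      forall i, (0 < i < size s)%N -> (xs s i < ys s i)%O
    & forall i j, (i.+2 <= j <= size s)%N -> ~~ (xs s j <= ys s i)%O].

Definition reduced (n : int) (s : zseq) : Prop :=
  forall i j, (i < j <= size s)%N -> (xs s i <= ys s j)%O ->
    qdist n (xs s i) (ys s j) < qalt n (xs s) (ys s) i j.

Definition Nseq (eps : int) : set zseq := [set s | condN s /\ reduced eps s].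

Definition polytope (R : realType) (eps : int) (s : zseq) :
    set {ffun jirr -> R^o} :=
  [set nu | (forall z z', covered z z' -> ext nu z - ext nu z' >= eps%:~R) /\
     (forall i, (i <= size s)%N ->
        ext nu (xs s i) - ext nu (ys s i) = (qdist eps (xs s i) (ys s i))%:~R)].

Definition dilated_lattice_point (R : realType) (C : set {ffun jirr -> R^o})
    (n : nat) (nu : jirr -> int) : Prop :=
  exists2 c, C c & forall x, (nu x)%:~R = n%:R * c x.

End JoinIrreducible.

Arguments Nseq {d H} eps _.
Arguments polytope {d H} R eps s _.

(* The affine hull of C is c + U, for any point c of C. *)
Definition affine_dim (R : fieldType) (V : vectType R) (C : set V) (n : nat) :
    Prop :=
  exists2 c, C c & exists U : {vspace V},
    [/\ forall v, C v -> v - c \in U,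
        forall W : {vspace V}, (forall v, C v -> v - c \in W) -> (U <= W)%VS
      & \dim U = n].

Section Hibi.
Variables (K : fieldType) (d : Order.disp_t) (H : finTBDistrLatticeType d).
Notation P := (jirr H).

(* K(T_x | x in P), in which all rings and fractional ideals below live. *)
Definition ambient : fieldType := {fraction {mpoly K[#|{: P}|]}}.

Definition kconst (c : K) : ambient := FracField.tofrac (c%:MP).

Definition Tvar (x : P) : ambient := FracField.tofrac 'X_(enum_rank x).

Definition Tmon (nu : P -> int) : ambient := \prod_(x : P) Tvar x ^ nu x.

Definition hibi_gens : set ambient :=
  [set f | exists2 I : {set P},
     I != finset.set0 /\ (forall x y, y \in I -> (x <= y)%O -> x \in I)
     & f = \prod_(x in I) Tvar x].

Definition hibi : set ambient := alggen kconst hibi_gens.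

(* deg T_x0 = 1, and deg T_x = 0 for x != x0. *)
Definition homogeneous (n : nat) (f : ambient) : Prop :=
  exists2 p : {mpoly K[#|{: P}|]}, f = FracField.tofrac p
    & forall m, m \in msupp p -> m (enum_rank (x0 H)) = n.

Definition irrelevant : set ambient :=
  modgen hibi [set f | hibi f /\ exists2 n, (0 < n)%N & homogeneous n f].

Definition Qfrac : set ambient :=
  [set f | exists a b, [/\ hibi a, hibi b, b != 0 & f = a / b]].

Definition idmul (I J : set ambient) : set ambient :=
  modgen hibi [set a * b | a in I & b in J].

Fixpoint idpow (J : set ambient) (n : nat) : set ambient :=
  if n is n'.+1 then idmul J (idpow J n') else hibi.

(* R :_{Q(R)} I *)
Definition colon (I : set ambient) : set ambient :=
  [set f | Qfrac f /\ forall a, I a -> hibi (f * a)].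

Definition divmul (I J : set ambient) : set ambient := colon (colon (idmul I J)).

(* Powers in Div(R), where the inverse of I is R : I. *)
Definition divpow (I : set ambient) (n : int) : set ambient :=
  match n with
  | Posz k => iter k (divmul I) hibi
  | Negz k => iter k.+1 (divmul (colon I)) hibi
  end.

Definition Tset (n : int) : set (P -> int) :=
  [set nu | forall z z', covered z z' -> ext nu z - ext nu z' >= n].

Definition omega : set ambient := modgen (range kconst) (Tmon @` Tset 1).

Definition anticanonical : set ambient := divpow omega (-1).

End Hibi.

Arguments kconst K {d} H c.
Arguments hibi K {d} H _.
Arguments irrelevant K {d} H _.
Arguments omega K {d} H _.
Arguments anticanonical K {d} H _.

Section Closure.
Variables (L : comNzRingType).
Implicit Types (A G M : set L).

Lemma submod_modgen A G : submod A (modgen A G).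
Proof.
split=> [S [[]]//|u v hu hv S hS|a u Aa hu S hS].
  by case: (hS) => -[_ hB _] _; apply: hB; [apply: hu | apply: hv].
by case: (hS) => -[_ _ hM] _; apply: hM => //; apply: hu.
Qed.

Lemma submod_add A M u v : submod A M -> M u -> M v -> M (u + v).
Proof.
move=> [M0 MB _] Mu Mv; have MNv : M (- v) by rewrite -sub0r; apply: MB.
by rewrite -[v]opprK; apply: MB.
Qed.

Lemma submod_sum A M (I : Type) (r : seq I) (Q : pred I) (F : I -> L) :
  submod A M -> (forall i, Q i -> M (F i)) -> M (\sum_(i <- r | Q i) F i).
Proof.
move=> hM hF; apply: (big_ind (fun x => M x)) => //; first by case: hM.
by move=> u v; apply: submod_add hM.
Qed.

Lemma modgen_min A G M : submod A M -> G `<=` M -> modgen A G `<=` M.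
Proof. by move=> hM hG; apply: smallest_sub. Qed.

Lemma subalgebra_alggen (K : comNzRingType) (iota : K -> L) G :
  subalgebra iota (alggen iota G).
Proof.
split=> [c S [[]]//|u v hu hv S hS|u v hu hv S hS];
  case: (hS) => -[_ hB hM] _.
  by apply: hB; [apply: hu | apply: hv].
by apply: hM; [apply: hu | apply: hv].
Qed.

End Closure.

Section FiberCone.
Variables (K : fieldType) (d : Order.disp_t) (H : finTBDistrLatticeType d).
Notation P := (jirr H).
Notation L := (ambient K H).
Notation hibi := (hibi K H).
Implicit Types (I J M : set L).

Lemma hibiP : subalgebra (kconst K H) hibi.
Proof. exact: subalgebra_alggen. Qed.

Lemma hibi1 : hibi 1.
Proof.
by have [/(_ 1) + _ _] := hibiP; rewrite /kconst mpolyC1 tofrac1.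
Qed.

Lemma hibi_submod : submod hibi hibi.
Proof.
have [_ hB hM] := hibiP; split=> //.
by rewrite -(subrr 1); apply: hB; apply: hibi1.
Qed.

Lemma submod_idmul I J : submod hibi (idmul I J).
Proof. exact: submod_modgen. Qed.

Lemma submod_idpow J n : submod hibi (idpow J n).
Proof. by case: n => [|n]; [exact: hibi_submod | exact: submod_idmul]. Qed.

Lemma idmul_in I J a b : I a -> J b -> idmul I J (a * b).
Proof. by move=> Ia Jb S [_]; apply; exists a => //; exists b. Qed.

Lemma idmul_rec I J M : submod hibi M ->
  (forall a b, I a -> J b -> M (a * b)) -> idmul I J `<=` M.
Proof.
by move=> hM h; apply: modgen_min => // _ [a Ia [b Jb <-]]; apply: h.
Qed.

Lemma submod_preim M c : submod hibi M -> submod hibi [set u | M (u * c)].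
Proof.
case=> M0 MB MZ; split=> /=; first by rewrite mul0r.
  by move=> u v hu hv; rewrite mulrBl; apply: MB.
by move=> a u ha hu; rewrite -mulrA; apply: MZ.
Qed.

Lemma idpowD J n m a b :
  idpow J n a -> idpow J m b -> idpow J (n + m) (a * b).
Proof.
elim: n a => [|n IH] a /=.
  by rewrite add0n => ha hb; have [_ _ hZ] := submod_idpow J m; exact: hZ.
move=> ha hb; move: a ha.
apply: (idmul_rec (M := [set u | idmul J (idpow J (n + m)) (u * b)])).
  exact: submod_preim (submod_idmul _ _).
move=> u v Ju hv /=; rewrite -mulrA; apply: idmul_in => //; exact: IH.
Qed.

Lemma idmulpowD I J n m a b :
  idpow J n a -> idmul I (idpow J m) b -> idmul I (idpow J (n + m)) (a * b).
Proof.
move=> ha hb; rewrite mulrC; move: b hb.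
apply: (idmul_rec (M := [set u | idmul I (idpow J (n + m)) (u * a)])).
  exact: submod_preim (submod_idmul _ _).
move=> u v Iu hv /=; rewrite -mulrA [v * a]mulrC.
by apply: idmul_in => //; apply: idpowD.
Qed.

(* The Rees algebra, the sum of the J^n Y^n inside L[Y]. *)
Definition rees_pred (J : set L) (p : {poly L}) : bool :=
  `[< forall n, idpow J n p`_n >].

Lemma rees_subring J : subring_closed (rees_pred J).
Proof.
split.
- apply/asboolP => -[|n]; rewrite coef1 /=; first exact: hibi1.
  by case: (submod_idpow J n.+1).
- move=> p q /asboolP hp /asboolP hq; apply/asboolP => n.
  by rewrite coefB; case: (submod_idpow J n) => _ hB _; exact: hB.
- move=> p q /asboolP hp /asboolP hq; apply/asboolP => n.
  rewrite coefM; apply: submod_sum (submod_idpow J n) _ => i _.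
  have := @idpowD J i (n - i) p`_i q`_(n - i) (hp _) (hq _).
  by rewrite subnKC // -ltnS.
Qed.

HB.instance Definition _ J :=
  GRing.isSubringClosed.Build {poly L} (rees_pred J) (rees_subring J).

Record rees (J : set L) : predArgType :=
  Rees { rees_val : {poly L}; _ : rees_val \in rees_pred J }.

HB.instance Definition _ J := [isSub for @rees_val J].
HB.instance Definition _ J := [Choice of rees J by <:].
HB.instance Definition _ J := [SubChoice_isSubComNzRing of rees J by <:].

(* The ideal generated by the irrelevant ideal m in the Rees algebra, namely
   the sum of the (m J^n) Y^n. *)
Definition rees_m (J : set L) (p : rees J) : bool :=
  `[< forall n, idmul (irrelevant K H) (idpow J n) (val p)`_n >].

Lemma irrelevant_proper : ~ idmul (irrelevant K H) hibi 1.
Proof.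
pose tf := @FracField.tofrac {mpoly K[#|{: P}|]}.
have hibi_poly : hibi `<=` range tf.
  apply: smallest_sub; first split.
  - by move=> c; exists c%:MP.
  - by move=> _ _ [p _ <-] [q _ <-]; exists (p - q); rewrite // /tf tofracB.
  - by move=> _ _ [p _ <-] [q _ <-]; exists (p * q); rewrite // /tf tofracM.
  move=> _ [I _ ->]; exists (\prod_(x in I) 'X_(enum_rank x)) => //.
  by rewrite /tf rmorph_prod.
pose Z : set L := [set f | exists2 p, f = tf p & p@_0%MM = 0].
have hZ : submod hibi Z.
  split; first by exists 0; rewrite ?mcoeff0 // /tf tofrac0.
    move=> _ _ [p -> hp] [q -> hq]; exists (p - q); first by rewrite /tf tofracB.
    by rewrite mcoeffB hp hq subr0.
  move=> a _ /hibi_poly [p _ <-] [q -> hq]; exists (p * q).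
    by rewrite /tf tofracM.
  by rewrite (rmorphM (mcoeff 0%MM)) /= hq mulr0.
have irrZ : irrelevant K H `<=` Z.
  apply: modgen_min => // f [_ [n n0 [p -> hp]]]; exists p => //.
  apply: memN_msupp_eq0; apply/negP => /hp; rewrite mnm0E => e.
  by rewrite -e in n0.
have subZ : idmul (irrelevant K H) hibi `<=` Z.
  apply: idmul_rec => // a b /irrZ Za hb; rewrite mulrC.
  by case: hZ => _ _ hM; exact: hM.
move=> /subZ [p]; rewrite /tf -tofrac1 => /eqP; rewrite tofrac_eq => /eqP <-.
by rewrite mcoeff1 eqxx => /eqP; rewrite oner_eq0.
Qed.

Lemma rees_m_ideal J : idealr_closed (@rees_m J).
Proof.
split.
- by apply/asboolP => n; rewrite coef0; case: (submod_idmul (irrelevant K H) (idpow J n)).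
- by apply/asboolP => /(_ 0%N); rewrite coef1; apply: irrelevant_proper.
- move=> a u v /asboolP hu /asboolP hv; apply/asboolP => n.
  have /asboolP ha := valP a.
  have hn := submod_idmul (irrelevant K H) (idpow J n).
  have -> : val (a * u + v) = val a * val u + val v by [].
  rewrite coefD; apply: (submod_add hn) => //.
  rewrite coefM; apply: submod_sum hn _ => i _.
  have := idmulpowD (ha i) (hu (n - i)%N).
  by rewrite subnKC // -ltnS.
Qed.

HB.instance Definition _ J :=
  isIdealr.Build (rees J) (@rees_m J) (@rees_m_ideal J).

Definition rees_m_idealr (J : set L) : idealr (rees J) := @rees_m J.

(* The sum of the J^n / m J^n. *)
Definition fiber_cone (J : set L) : comNzRingType :=
  {ideal_quot (rees_m_idealr J)}.

Definition to_fiber_cone (J : set L) (p : rees J) : fiber_cone J :=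
  \pi_({ideal_quot (rees_m_idealr J)}) p.

Definition ehrhart (R : realType) (eps : int) (s : zseq H) : set {poly L} :=
  alggen (fun c : K => (kconst K H c)%:P)
    [set f | exists n nu, dilated_lattice_point (polytope R eps s) n nu /\
       f = (Tmon K nu)%:P * 'X^n].

(* The map sending T^nu Y^n to the class of T^nu in J^n / m J^n is the
   restriction of [to_fiber_cone] to [ehrhart R eps s]. *)
Definition ehrhart_embeds (R : realType) (eps : int) (J : set L) (s : zseq H) :
    Prop :=
  (forall p, ehrhart R eps s p -> p \in rees_pred J) /\
  (forall p q : rees J, ehrhart R eps s (val p) -> ehrhart R eps s (val q) ->
     to_fiber_cone p = to_fiber_cone q -> p = q).

Definition ehrhart_image (R : realType) (eps : int) (J : set L) (s : zseq H) :
    set (fiber_cone J) :=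
  [set to_fiber_cone p | p in [set p : rees J | ehrhart R eps s (val p)]].

End FiberCone.

Arguments ehrhart K {d H} R eps s _.
Arguments ehrhart_image {K d H} R eps J s _.

(* Main.v *)
Require Import Defs.
From HB Require Import structures.
From mathcomp Require Import all_boot all_order all_algebra.
From mathcomp Require Import boolp classical_sets reals.
From mathcomp Require Import mpoly zify ring lra.

(* A monomial T^nu with nu in T^(n eps) is nonzero in the fiber cone exactly when
   no order ideal of P can be split off from nu, and then infinity is reachable
   from x_0 by climbing along tight covers and descending freely; a shortest such
   route is a reduced sequence satisfying condition N along which nu is tight.
   Hence the fiber cone has a monomial basis covered by the cones over the
   polytopes C_s, the product of two basis monomials being their product if they
   lie in a common cone and zero otherwise.

   Krull dimension: elements f_i in p_i \ p_{i-1} of a chain of primes are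
   algebraically independent modulo p_0.  The monomials of the f_i outside p_0
   have nonzero product, so they lie in one cone, where there are too few lattice
   points for more than dim C_s + 1 independent elements.  Conversely, killing the
   monomials outside one cone and then setting to 1, one at a time, coordinates
   that are independent on the cone produces a chain of primes of that length. *)

Set Implicit Arguments.
Unset Strict Implicit.
Unset Printing Implicit Defensive.
Import Order.TTheory GRing.Theory Num.Theory.
Local Open Scope classical_set_scope.
Local Open Scope ring_scope.

(** * Linear combinations and Laurent monomials *)

(** Both cases are one proof in the parameter [eps]. The canonical ideal is by definition the span
    of [Tset 1]; for the anticanonical ideal the double colon must be shown to give the span of
    [Tset (-1)], which works because every cover is tight for some exponent. Powers of these ideals
    are controlled by dividing an exponent by n and rounding down.

    The fiber cone need not be a domain, so its dimension cannot be read off from a transcendence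
    degree; prime chains are handled directly, and the upper bound is a growth count.

    The dimension of C_s refers to a real affine hull, whereas the fiber cone sees only lattice
    points. The bridge is that C_s is cut out by integral bounds on differences of coordinates,
    which rounding respects. The summand 1 in the dimension formula is the degree, stored as an
    extra coordinate at infinity. *)

Section LinComb.
Variables (K : nzRingType) (E : eqType).
Implicit Types (r : seq (K * E)) (e : E).

(** Lists of terms are not reduced: exponents may repeat and coefficients may vanish, so that sums
    are concatenations. The true coefficient is therefore a sum over occurrences. *)
Definition lincoef r e : K := \sum_(p <- r | p.2 == e) p.1.

Lemma lincoef_notin r e : e \notin unzip2 r -> lincoef r e = 0.
Proof.
move=> er; rewrite /lincoef big_seq_cond big1 // => p /andP[pr /eqP pe].
by case/negP: er; rewrite -pe map_f.
Qed.

Lemma lincoef_cat r1 r2 e : lincoef (r1 ++ r2) e = lincoef r1 e + lincoef r2 e.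
Proof. by rewrite /lincoef big_cat. Qed.

Definition lincomb_neg r := [seq (- p.1, p.2) | p <- r].

Lemma lincoef_opp r e : lincoef (lincomb_neg r) e = - lincoef r e.
Proof. by rewrite /lincoef big_map /= sumrN. Qed.

Section Eval.
Variables (A : comNzRingType) (k : {rmorphism K -> A}) (b : E -> A).

Definition lincomb r : A := \sum_(p <- r) k p.1 * b p.2.

Lemma lincomb_nil : lincomb [::] = 0. Proof. exact: big_nil. Qed.

Lemma lincomb_cons p r : lincomb (p :: r) = k p.1 * b p.2 + lincomb r.
Proof. exact: big_cons. Qed.

Lemma lincomb_cat r1 r2 : lincomb (r1 ++ r2) = lincomb r1 + lincomb r2.
Proof. exact: big_cat. Qed.

Lemma lincomb_opp r : lincomb (lincomb_neg r) = - lincomb r.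
Proof.
by rewrite /lincomb big_map -sumrN; apply: eq_bigr => p _; rewrite rmorphN mulNr.
Qed.

Lemma lincomb_cf r : lincomb r = \sum_(e <- undup (unzip2 r)) k (lincoef r e) * b e.
Proof.
under eq_bigr => e _ do rewrite rmorph_sum mulr_suml big_mkcond /=.
rewrite exchange_big /= /lincomb big_seq [RHS]big_seq; apply: eq_bigr => p pr.
rewrite (bigD1_seq p.2) ?undup_uniq ?mem_undup ?map_f //= eqxx.
by rewrite big1 ?addr0 // => e /negbTE; rewrite eq_sym => ->.
Qed.

End Eval.

Lemma eq_lincomb (A : comNzRingType) (k : {rmorphism K -> A}) (b1 b2 : E -> A) r :
  (forall p, p \in r -> b1 p.2 = b2 p.2) -> lincomb k b1 r = lincomb k b2 r.
Proof. by move=> h; rewrite /lincomb; apply: eq_big_seq => p /h ->. Qed.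

Lemma lincomb_cf0 (A : comNzRingType) (k : {rmorphism K -> A}) (b : E -> A) r :
  (forall e, e \in unzip2 r -> b e <> 0 -> lincoef r e = 0) -> lincomb k b r = 0.
Proof.
move=> h; rewrite lincomb_cf big_seq big1 // => e; rewrite mem_undup => er.
have [->|/eqP b0] := eqVneq (b e) 0; first by rewrite mulr0.
by rewrite h // rmorph0 mul0r.
Qed.

(** Passing to a reduced list makes membership of a term equivalent to a nonzero coefficient. *)
Lemma lincomb_reduce (A : comNzRingType) (k : {rmorphism K -> A}) (b : E -> A) (s : seq (K * E)) :
  exists s', [/\ lincomb k b s' = lincomb k b s, forall e, lincoef s' e = lincoef s e
    & forall p, p \in s' -> p.1 = lincoef s p.2 /\ p.1 != 0].
Proof.
pose ks := [seq e <- undup (unzip2 s) | lincoef s e != 0].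
exists [seq (lincoef s e, e) | e <- ks]; split.
- rewrite {1}/lincomb big_map big_filter lincomb_cf big_mkcond /=.
  by apply: eq_bigr => e _; case: eqVneq => [->|]//=; rewrite rmorph0 mul0r.
- move=> e; rewrite {1}/lincoef big_map /=.
  have us : uniq ks by rewrite filter_uniq // undup_uniq.
  have [es|es] := boolP (e \in ks).
    rewrite big_mkcond (bigD1_seq e) //= eqxx big1 ?addr0 // => i /negbTE.
    by move=> ->.
  rewrite big_seq_cond big1 => [|i /andP[ii /eqP ei]]; last by rewrite -ei ii in es.
  apply/esym/eqP/contraT => h.
  by rewrite mem_filter h /= mem_undup in es; rewrite lincoef_notin // eqxx in h.
- move=> p /mapP[e]; rewrite mem_filter => /andP[h _] -> /=.
  by split.
Qed.

End LinComb.

Section Laurent.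
Variables (K : fieldType) (I : finType).
Notation L := {fraction {mpoly K[#|I|]}}.
Notation tf := (@FracField.tofrac {mpoly K[#|I|]}).
Implicit Types (e : I -> int) (r : seq (K * (I -> int))).

(** With [lvar] and [lmon], a version of [kconst], [Tvar] and [Tmon] for any finite index type. It
    is convertible to these on join-irreducibles and serves also for exponents indexed by
    [pplus]. *)
Definition lconst : K -> L := tf \o @mpolyC #|I| K.
HB.instance Definition _ := GRing.RMorphism.on lconst.

Definition lvar (i : I) : L := tf 'X_(enum_rank i).

Definition lmon e : L := \prod_(i : I) lvar i ^ e i.

Lemma lvar_neq0 i : lvar i != 0.
Proof. by rewrite tofrac_eq0 -msupp_eq0 msuppX. Qed.

Lemma lmon_neq0 e : lmon e != 0.
Proof. by apply/prodf_neq0 => i _; rewrite expfz_neq0 // lvar_neq0. Qed.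

Lemma lmon0 : lmon (fun=> 0) = 1.
Proof. by rewrite /lmon big1. Qed.

Lemma lmonD e1 e2 : lmon (fun i => e1 i + e2 i) = lmon e1 * lmon e2.
Proof.
by rewrite -big_split; apply: eq_bigr => i _ /=; rewrite expfzDr // lvar_neq0.
Qed.

Lemma lmon_nat (m : I -> nat) :
  lmon (fun i => m i) = tf 'X_[[multinom m (enum_val j) | j < #|I|]].
Proof.
rewrite /lmon mpolyXE_id rmorph_prod /= (reindex (@enum_val I predT)) /=; last first.
  by apply: onW_bij; exact: enum_val_bij.
apply: eq_bigr => j _; rewrite rmorphXn /= mnmE.
by rewrite /lvar enum_valK -exprnP.
Qed.

Definition shiftm (N : nat) e : 'X_{1..#|I|} :=
  [multinom absz (e (enum_val j) + N%:Z)%R | j < #|I|].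

Lemma lincomb_shift N r : (forall p i, p \in r -> 0 <= p.2 i + N%:Z) ->
  lincomb lconst lmon r * lmon (fun=> N%:Z)
   = tf (\sum_(p <- r) p.1 *: 'X_[shiftm N p.2]).
Proof.
move=> h; rewrite /lincomb mulr_suml rmorph_sum /=; apply: eq_big_seq => p pr.
rewrite -mulrA -lmonD -mul_mpolyC rmorphM /= /shiftm -(lmon_nat (fun i => absz (p.2 i + N%:Z))); congr (_ * lmon _).
by apply/funext => i; rewrite gez0_abs // h.
Qed.

Lemma exp_bound r : exists N : nat, forall p i, p \in r -> 0 <= p.2 i + N%:Z.
Proof.
exists (\sum_(p <- r) \sum_i absz (p.2 i))%N => p i pr.
have h1 : (absz (p.2 i) <= \sum_i absz (p.2 i))%N.
  by rewrite (bigD1 i) //= leq_addr.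
have h2 : (\sum_i absz (p.2 i) <= \sum_(p <- r) \sum_i absz (p.2 i))%N.
  by rewrite (big_rem p) //= leq_addr.
lia.
Qed.

(** Multiplying by a high power of all variables clears denominators, and the shift is injective on
    the exponents that occur; distinct monomials of the polynomial ring are independent. *)
Lemma lmon_indep r e : lincomb lconst lmon r = 0 -> lincoef r e = 0.
Proof.
have [er|/lincoef_notin-> //] := boolP (e \in unzip2 r).
have [N hN] := exp_bound r.
move=> h0; have := lincomb_shift hN; rewrite h0 mul0r => /esym/eqP.
rewrite tofrac_eq0 => /eqP/(congr1 (mcoeff (shiftm N e))).
rewrite mcoeff0 raddf_sum /= => h; rewrite -[RHS]h /lincoef big_mkcond /=.
apply: eq_big_seq => p pr; rewrite mcoeffZ mcoeffX.
have [->|pe] := eqVneq p.2 e; first by rewrite eqxx mulr1.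
case: eqVneq => /=; last by rewrite mulr0.
move=> /mnmP sm; case/eqP: pe; apply/funext => i.
have [q qr eq] := mapP er.
have := sm (enum_rank i); rewrite !mnmE enum_rankK.
by have := hN p i pr; have := hN q i qr; rewrite -eq => a1 a2 /(congr1 Posz); rewrite !gez0_abs // => /addIr ->.
Qed.

Lemma lmon_inj e1 e2 : lmon e1 = lmon e2 -> e1 = e2.
Proof.
move=> h; apply/eqP/contraT => ne.
have := @lmon_indep [:: (1, e1); (-1, e2)] e1.
rewrite lincomb_cons lincomb_cons lincomb_nil /= rmorph1 rmorphN rmorph1 h addr0 mul1r mulN1r.
rewrite subrr /lincoef !big_cons big_nil /= eqxx eq_sym (negbTE ne) addr0 => /(_ erefl).
by move/eqP; rewrite oner_eq0.
Qed.

End Laurent.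

(** * Prime chains in monomial algebras *)

Lemma posneg_split (x : int) :
  (absz (Num.max x 0))%:Z - (absz (Num.max (- x) 0))%:Z = x.
Proof.
have [x0|x0] := leP 0 x.
  by rewrite (max_idPr _) ?oppr_le0 // subr0 gez0_abs.
by rewrite (max_idPl _) ?oppr_ge0 ?ltW // sub0r gtz0_abs ?oppr_gt0 // opprK.
Qed.

Section PrimeKernel.
Variables (A : comNzRingType) (D : idomainType) (phi : {rmorphism A -> D}).

Definition kernel_pred : A -> bool := fun a => phi a == 0.

Lemma kernel_idealr : idealr_closed kernel_pred.
Proof.
split=> [||a u v /eqP hu /eqP hv].
- by rewrite unfold_in /kernel_pred rmorph0.
- by rewrite unfold_in /kernel_pred rmorph1 oner_eq0.
- by rewrite unfold_in /kernel_pred rmorphD rmorphM hu hv mulr0 addr0.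
Qed.

HB.instance Definition _ := isIdealr.Build A kernel_pred kernel_idealr.

Lemma kernel_prime : prime_idealr_closed kernel_pred.
Proof. by move=> u v; rewrite !unfold_in /kernel_pred rmorphM mulf_eq0. Qed.

HB.instance Definition _ := isPrimeIdealrClosed.Build A kernel_pred kernel_prime.

Lemma ker_prime : exists q : prime_idealr A, forall a, (a \in q) = (phi a == 0).
Proof. by exists kernel_pred. Qed.

End PrimeKernel.

(** * Algebraic independence along a chain of primes *)

Section ChainIndependent.
Variables (K : fieldType) (A : comNzRingType) (k : {rmorphism K -> A}).
Implicit Types (F : seq A) (a : seq nat) (r : seq (K * seq nat)).

Definition mexp F a : A := \prod_(x <- zip F a) x.1 ^+ x.2.

Lemma mexp_cons f F n a : mexp (f :: F) (n :: a) = f ^+ n * mexp F a.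
Proof. by rewrite /mexp /= big_cons. Qed.

Lemma kconst_prime (q : prime_idealr A) c : k c \in q -> c = 0.
Proof.
move=> kq; apply/eqP/contraT => c0.
by rewrite -(idealr1 q) -(rmorph1 k) -(mulVf c0) rmorphM idealMr.
Qed.

Lemma prime_notinX (q : prime_idealr A) f n : f \notin q -> f ^+ n \notin q.
Proof.
move=> fq; elim: n => [|n IH]; first by rewrite expr0 idealr1.
by rewrite exprS prime_idealrM negb_or fq.
Qed.

Lemma chain_indep F (P : nat -> prime_idealr A) r :
  (forall i, (i < size F)%N ->
     [/\ {subset P i <= P i.+1}, nth 0 F i \in P i.+1 & nth 0 F i \notin P i]) ->
  (forall p, p \in r -> size p.2 = size F) ->
  lincomb k (mexp F) r \in P 0%N -> forall a, lincoef r a = 0.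
Proof.
elim: F P r => [|f F IH] P r hF hr h0 a.
  have [ar|/lincoef_notin-> //] := boolP (a \in unzip2 r).
  have ra p : p \in r -> p.2 = a.
    move=> pr; have [q qr ->] := mapP ar.
    by rewrite (size0nil (hr p pr)) (size0nil (hr q qr)).
  apply: (@kconst_prime (P 0%N)).
  suff -> : k (lincoef r a) = lincomb k (mexp [::]) r by [].
  rewrite /lincomb /lincoef big_mkcond rmorph_sum; apply: eq_big_seq => p pr /=.
  by rewrite (ra p pr) eqxx /mexp; case: (a) => [|? ?]; rewrite big_nil mulr1.
have [hs hf1 hf0] := hF 0%N isT; rewrite /= in hf1 hf0.
apply/eqP/contraT => ca.
have [r' [lr' cr' hr']] := lincomb_reduce k (mexp (f :: F)) r.
have szr' p : p \in r' -> size p.2 = (size F).+1.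
  move=> /hr'[p1 pn]; have [|/lincoef_notin c0] := boolP (p.2 \in unzip2 r).
    by move=> /mapP[q /hr qs ->].
  by rewrite p1 c0 eqxx in pn.
have inr' a' : lincoef r a' != 0 -> a' \in unzip2 r'.
  by apply: contraNT => h; rewrite -cr' lincoef_notin.
have exd : exists d, has (fun p => head 0%N p.2 == d) r'.
  exists (head 0%N a); have [p pr pa] := mapP (inr' _ ca).
  by apply/hasP; exists p => //; rewrite -pa.
(* After division by the lowest power of [f], which is not in [P 0], and reduction
   modulo [P 1], only the terms with the lowest exponent of [f] survive. *)
pose d := ex_minn exd.
have [[p0 p0r /eqP p0d] dmin] :
    (exists2 p, p \in r' & head 0%N p.2 == d) /\
    forall p, p \in r' -> (d <= head 0%N p.2)%N.
  rewrite /d; case: ex_minnP => dd /hasP hd hm; split=> // p pr.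
  by apply: hm; apply/hasP; exists p.
pose r0 := [seq (p.1, behead p.2) | p <- r' & head 0%N p.2 == d].
pose x := \sum_(p <- r') k p.1 * (f ^+ (head 0%N p.2 - d) * mexp F (behead p.2)).
have xE : lincomb k (mexp (f :: F)) r = f ^+ d * x.
  rewrite -lr' /lincomb /x mulr_sumr; apply: eq_big_seq => p pr.
  have := szr' p pr; have := dmin p pr; case: p.2 => [//|n a'] /= dn _.
  by rewrite mexp_cons [RHS]mulrCA; congr (_ * _); rewrite mulrA -exprD subnKC.
have x1 : x \in P 1%N.
  apply: hs; have : f ^+ d * x \in P 0%N by rewrite -xE.
  by rewrite prime_idealrM (negbTE (prime_notinX d hf0)).
have lr0 : lincomb k (mexp F) r0 \in P 1%N.
  have -> : lincomb k (mexp F) r0 = x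
     - \sum_(p <- r' | head 0%N p.2 != d)
         k p.1 * (f ^+ (head 0%N p.2 - d) * mexp F (behead p.2)).
    rewrite /x (bigID (fun p => head 0%N p.2 == d)) /= addrK /lincomb big_map big_filter /=.
    by apply: eq_bigr => p /eqP->; rewrite subnn mul1r.
  (* The terms with a higher exponent retain a factor [f], which lies in [P 1]. *)
  rewrite rpredB // big_seq_cond rpred_sum // => p /andP[pr pd].
  have : (0 < head 0%N p.2 - d)%N.
    by rewrite subn_gt0 ltn_neqAle eq_sym pd dmin.
  case: (_ - d)%N => // n _; rewrite exprS -mulrA mulrCA mulrC.
  by rewrite idealMr.
have := IH (fun i => P i.+1) r0 _ _ lr0 (behead p0.2).
have -> : lincoef r0 (behead p0.2) = lincoef r' p0.2.
  rewrite /lincoef /r0 big_map big_filter_cond /=.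
  rewrite big_seq_cond [RHS]big_seq_cond; apply: eq_bigl => p.
  case pr: (p \in r') => //=; rewrite -p0d.
  have := szr' p pr; have := szr' _ p0r.
  by case: p.2 => [//|? ?]; case: p0.2 => [//|? ?] _ _ /=; rewrite eqseq_cons.
have [p1 pn] := hr' _ p0r.
rewrite cr' -p1 => h; rewrite h ?eqxx // in pn.
  by move=> i iF; apply: (hF i.+1).
by move=> p /mapP[q]; rewrite mem_filter => /andP[_ /szr' sq] -> /=; rewrite size_behead sq.
Qed.

End ChainIndependent.

(** * Algebras with a monomial basis *)

Section MonomialAlgebra.
Variables (K : fieldType) (I : finType) (A : comNzRingType).
Variables (k : {rmorphism K -> A}) (G : (I -> int) -> Prop) (b : (I -> int) -> A).
Implicit Types (e : I -> int) (r : seq (K * (I -> int))).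
Notation "e1 +e e2" := (fun i : I => e1 i + e2 i : int) (at level 50).
Notation e0 := (fun _ : I => 0 : int).

(* The [b e] with [e] in [G] form a basis of [A], and products leaving [G] vanish. *)
Hypothesis G0 : G e0.
Hypothesis b0 : b e0 = 1.
Hypothesis bM : forall e1 e2, G e1 -> G e2 -> b (e1 +e e2) = b e1 * b e2.
Hypothesis bN : forall e, ~ G e -> b e = 0.
Hypothesis bgen : forall a, exists r, a = lincomb k b r.
Hypothesis bind : forall r e, lincomb k b r = 0 -> G e -> lincoef r e = 0.

(** The last clause says that the exponents of [G] outside [S] absorb addition, so that killing
    their monomials is compatible with products. *)
Definition face (S : (I -> int) -> Prop) : Prop :=
  [/\ S e0, forall e, S e -> G e, forall e1 e2, S e1 -> S e2 -> S (e1 +e e2)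
    & forall e1 e2, G e1 -> G e2 -> S (e1 +e e2) -> S e1 /\ S e2].

Section FaceMorphism.
Variables (S : (I -> int) -> Prop) (L : comNzRingType) (kL : {rmorphism K -> L}).
Variable w : (I -> int) -> L.
Hypothesis Sf : face S.
Hypothesis w0 : w e0 = 1.
Hypothesis wM : forall e1 e2, w (e1 +e e2) = w e1 * w e2.

Definition face_weight e : L := if `[< S e >] then w e else 0.

Lemma face_weightM e1 e2 : G e1 -> G e2 -> face_weight (e1 +e e2) = face_weight e1 * face_weight e2.
Proof.
have [_ SG SD SF] := Sf => g1 g2; rewrite /face_weight.
case: asboolP => [s12|s12].
  by have [s1 s2] := SF _ _ g1 g2 s12; rewrite !asboolT.
case: asboolP => [s1|]; last by rewrite mul0r.
case: asboolP => [s2|]; last by rewrite mulr0.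
by case: s12; apply: SD.
Qed.

(** Well defined because [face_weight] only sees exponents in [S], hence in [G], and there
    coefficients are determined by the element. *)
Lemma face_morphism :
  exists phi : {rmorphism A -> L}, forall r, phi (lincomb k b r) = lincomb kL face_weight r.
Proof.
have [_ SG _ _] := Sf.
have wd r1 r2 : lincomb k b r1 = lincomb k b r2 -> lincomb kL face_weight r1 = lincomb kL face_weight r2.
  move=> h; apply/eqP; rewrite -subr_eq0 -lincomb_opp -lincomb_cat; apply/eqP.
  apply: lincomb_cf0 => e _; rewrite {1}/face_weight; case: asboolP => // /SG ge _.
  by apply: bind => //; rewrite lincomb_cat lincomb_opp h subrr.
pose phi a := lincomb kL face_weight (projT1 (cid (bgen a))).
have phiE r : phi (lincomb k b r) = lincomb kL face_weight r.
  by rewrite /phi; case: cid => r' /= /esym/wd.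
have phiB : zmod_morphism phi.
  move=> x y; have [r ->] := bgen x; have [r' ->] := bgen y.
  by rewrite -lincomb_opp -lincomb_cat !phiE lincomb_cat lincomb_opp.
have redG r : exists r', lincomb k b r = lincomb k b r' /\ forall p, p \in r' -> G p.2.
  exists [seq p <- r | `[< G p.2 >]]; split; last first.
    by move=> p; rewrite mem_filter => /andP[/asboolP].
  rewrite /lincomb big_filter [RHS]big_mkcond; apply: eq_bigr => p _.
  by case: asboolP => // /bN ->; rewrite mulr0.
have phiM : monoid_morphism phi.
  split=> [|x y].
    have -> : 1 = lincomb k b [:: (1, e0)].
      by rewrite lincomb_cons lincomb_nil /= rmorph1 b0 mulr1 addr0.
    rewrite phiE lincomb_cons lincomb_nil /= rmorph1 mul1r addr0 /face_weight asboolT //.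
    by case: Sf.
  have [r ->] := bgen x; have [r' ->] := bgen y.
  have [{}r [-> rG]] := redG r; have [{}r' [-> rG']] := redG r'.
  have prodE (M : comNzRingType) (kM : {rmorphism K -> M}) (v : (I -> int) -> M) :
    (forall e1 e2, G e1 -> G e2 -> v (e1 +e e2) = v e1 * v e2) ->
    lincomb kM v r * lincomb kM v r' =
      lincomb kM v [seq (p.1 * q.1, p.2 +e q.2) | p <- r, q <- r'].
    move=> vM; rewrite /lincomb big_allpairs_dep /= mulr_suml.
    apply: eq_big_seq => p pr; rewrite mulr_sumr; apply: eq_big_seq => q qr.
    by rewrite (vM _ _ (rG _ pr) (rG' _ qr)) rmorphM mulrACA.
  by rewrite prodE // !phiE -prodE //; apply: face_weightM.
pose mB := GRing.isZmodMorphism.Build A L phi phiB.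
pose mM := GRing.isMonoidMorphism.Build A L phi phiM.
pose f : {rmorphism A -> L} := HB.pack phi mB mM.
by exists f.
Qed.

End FaceMorphism.

(** * A chain of primes from one face *)

Section LowerBound.
Variables (S : (I -> int) -> Prop) (n : nat) (J : 'I_n -> I) (v : 'I_n -> I -> int).
Hypothesis Sf : face S.
Hypothesis vS : forall i, S (v i).
Hypothesis vdet : \det (\matrix_(i, j) v i (J j)) != 0.

Definition keep (l : nat) e : I -> int :=
  fun i => if [exists j : 'I_n, (l <= j)%N && (i == J j)] then e i else 0.

Lemma keepD l e1 e2 : keep l (e1 +e e2) = (keep l e1 +e keep l e2).
Proof. by apply/funext => i; rewrite /keep; case: ifP; rewrite ?addr0. Qed.

Lemma keep_keep l l' e : (l <= l')%N -> keep l' (keep l e) = keep l' e.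
Proof.
move=> ll; apply/funext => i; rewrite /keep.
case: ifP => // /existsP[j /andP[lj ij]]; case: ifP => // /negbT/existsPn/(_ j).
by rewrite ij (leq_trans ll lj).
Qed.

(** A face is only a monoid, so coefficients must be natural; an integral combination is later split
    into its positive and negative parts. *)
Lemma face_natsum (c : 'I_n -> nat) :
  S (fun i => \sum_j (c j)%:Z * v j i).
Proof.
have [S0 _ SD _] := Sf.
have : forall s : seq 'I_n, S (fun i => \sum_(j <- s) (c j)%:Z * v j i).
  elim=> [|j s IH].
    by rewrite (_ : (fun _ => _) = e0) //; apply/funext => i; rewrite big_nil.
  rewrite (_ : (fun _ => _) =
     (fun i => (c j)%:Z * v j i) +e (fun i => \sum_(j <- s) (c j)%:Z * v j i)).
    apply: (SD) => //; elim: (c j) => [|m IHm].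
      by rewrite (_ : (fun _ => _) = e0) //; apply/funext => i; rewrite mul0r.
    rewrite (_ : (fun _ => _) = v j +e (fun i => m%:Z * v j i)); first exact: SD.
    by apply/funext => i; rewrite -addn1 PoszD mulrDl mul1r addrC.
  by apply/funext => i; rewrite big_cons.
by move=> /(_ (index_enum _)).
Qed.

(* The [l]-th prime is the kernel of the map sending the monomials outside [S] to 0
   and setting to 1 all the variables except the [J j] with [l <= j]. *)
Lemma face_chain : exists p : 'I_n.+1 -> prime_idealr A, prime_chain p.
Proof.
have [_ SG _ _] := Sf.
pose w l e := lmon K (keep l e).
have w0 l : w l e0 = 1.
  by rewrite /w -(lmon0 K I); congr lmon; apply/funext => i; rewrite /keep; case: ifP.
have wM l e1 e2 : w l (e1 +e e2) = w l e1 * w l e2 by rewrite /w keepD lmonD.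
have /choice[phi phiE] l := face_morphism (@lconst K I) Sf (w0 l) (wM l).
have /choice[p pE] l := ker_prime (phi l).
exists (fun l => p l) => i j ij; split.
  move=> a; rewrite !pE; have [r ->] := bgen a; rewrite !phiE => /eqP h.
  (* Vanishing under the [i]-th map is vanishing of the coefficients of the projected list, and the
     projection for [j] factors through the one for [i]. *)
  pose r' := [seq (x.1, keep i x.2) | x <- r & `[< S x.2 >]].
  have hw l (ww : (I -> int) -> {fraction {mpoly K[#|I|]}}) :
      (forall e, w l e = ww (keep i e)) ->
      lincomb (@lconst K I) (face_weight S (w l)) r = lincomb (@lconst K I) ww r'.
    move=> hh; rewrite /lincomb big_map big_filter [RHS]big_mkcond /=.
    apply: eq_bigr => x _; rewrite /face_weight hh; case: ifP => //; by rewrite mulr0.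
  apply/eqP; rewrite (hw j (w j)); last first.
    by move=> e; rewrite /w keep_keep // ltnW.
  apply: lincomb_cf0 => e _ _; apply: (@lmon_indep K I r' e).
  by rewrite -(hw i) //.
have i_n : (i < n)%N by rewrite (leq_trans ij) // -ltnS.
pose M := (\matrix_(i, j) v i (J j) : 'M[int]_n).
(* A row of the adjugate gives two points of [S] whose coordinates along [J] differ
   only at the [i]-th one. *)
pose adj x := (\adj M) (Ordinal i_n) x.
pose ap := fun x : I => \sum_j (absz (Num.max (adj j) 0))%:Z * v j x.
pose am := fun x : I => \sum_j (absz (Num.max (- adj j) 0))%:Z * v j x.
have apm y : ap (J y) - am (J y) = (\det M) *+ (Ordinal i_n == y).
  rewrite -[RHS](_ : (\adj M *m M) (Ordinal i_n) y = _); last first.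
    by rewrite mul_adj_mx mxE.
  rewrite mxE -sumrB; apply: eq_bigr => j0 _; rewrite -mulrBl [M _ _]mxE; congr (_ * _).
  exact: posneg_split.
(* This difference of two monomials separates the primes: the [j]-th map forgets the coordinate in
   which they differ, while the [i]-th keeps it, and the discrepancy there is the nonzero
   determinant. *)
pose x := lincomb k b [:: (1, ap); (-1, am)].
have pxE l : phi l x = lmon K (keep l ap) - lmon K (keep l am).
  rewrite phiE !lincomb_cons lincomb_nil /= rmorph1 rmorphN rmorph1 addr0 mul1r mulN1r.
  by rewrite /face_weight !asboolT //; apply: face_natsum.
move=> /(_ x); rewrite !pE !pxE => h.
suff /h : lmon K (keep j ap) - lmon K (keep j am) == 0.
  rewrite subr_eq0 => /eqP/lmon_inj/(congr1 (fun f => f (J (Ordinal i_n)))).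
  have hk : [exists j0 : 'I_n, (i <= j0)%N && (J (Ordinal i_n) == J j0)].
    by apply/existsP; exists (Ordinal i_n); rewrite leqnn eqxx.
  by rewrite /keep hk => /eqP; rewrite -subr_eq0 apm eqxx mulr1n (negbTE vdet).
rewrite subr_eq0; apply/eqP; congr lmon; apply/funext => z; rewrite /keep.
case: existsP => // -[y /andP[jy /eqP ->]].
apply/eqP; rewrite -subr_eq0 apm.
have /negbTE-> : Ordinal i_n != y by apply: contraTneq jy => <-; rewrite -ltnNge.
by rewrite mulr0n.
Qed.

End LowerBound.

(** * Bounding chains of primes by counting lattice points *)

Section UpperBound.
Variables (m : nat) (p : 'I_m.+1 -> prime_idealr A) (n : nat).
Hypothesis pc : prime_chain p.
(** The rank of a face enters only as a number of coordinates that separate its points, which is all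
    the count uses. *)
Hypothesis cone : forall e, G e -> exists S h (J : 'I_h -> I),
  [/\ (h <= n)%N, face S, S e
    & forall e1 e2, S e1 -> S e2 -> (forall j, e1 (J j) = e2 (J j)) -> e1 = e2].

Notation P := (fun i : nat => p (inord i)).
Notation q := (P 0%N).

Definition expo_sum (s : seq (I -> int)) : I -> int := fun i => \sum_(e <- s) e i.

Lemma expo_sum_cons e s : expo_sum (e :: s) = e +e expo_sum s.
Proof. by apply/funext => i; rewrite /expo_sum big_cons. Qed.

(** A product of monomials outside the prime [q] is outside [q], hence nonzero, so its exponent
    cannot leave [G]. A face containing the sum then contains every summand: finitely many monomials
    outside [q] share a face. *)
Lemma expo_sum_notin s : (forall e, e \in s -> G e /\ b e \notin q) ->
  G (expo_sum s) /\ b (expo_sum s) \notin q.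
Proof.
elim: s => [|e s IH] hs.
  rewrite (_ : expo_sum [::] = e0) ?b0 ?idealr1 //.
  by apply/funext => i; rewrite /expo_sum big_nil.
have [ge be] := hs e (mem_head _ _).
have [gs bs] := IH (fun e' h => hs e' (@mem_behead _ (e :: s) _ h)).
have bes : b (expo_sum (e :: s)) \notin q.
  by rewrite expo_sum_cons bM // prime_idealrM negb_or be.
split=> //; apply: contrapT => /bN h.
by rewrite h idealr0 in bes.
Qed.

Lemma expo_sum_face S s : face S -> (forall e, e \in s -> G e /\ b e \notin q) ->
  S (expo_sum s) -> forall e, e \in s -> S e.
Proof.
move=> [_ _ _ SF]; elim: s => // e s IH hs; rewrite expo_sum_cons => h e'.
have hs' e1 (h1 : e1 \in s) := hs e1 (@mem_behead _ (e :: s) _ h1).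
have [h1 h2] := SF _ _ (hs e (mem_head _ _)).1 (expo_sum_notin hs').1 h.
by rewrite inE => /predU1P[->|] //; apply: IH.
Qed.

Section Bounded.
Variables (S : (I -> int) -> Prop) (c : nat).
Hypothesis Sf : face S.

(* [c] bounds the coordinates of a finite set of generators, [D] the number of factors. *)
Definition bounded D e : Prop := S e /\ forall i, (absz (e i) <= c * D)%N.

(** A filtration modulo [q] whose levels add under products. With h separating coordinates, level D
    involves at most (2cD+1)^h exponents. *)
Definition spanned D (x : A) : Prop :=
  exists2 r, x - lincomb k b r \in q & forall y, y \in r -> bounded D y.2.

Lemma spannedW D D' x : (D <= D')%N -> spanned D x -> spanned D' x.
Proof.
move=> DD [r xr hr]; exists r => // y /hr[sy hy]; split=> // i.
by rewrite (leq_trans (hy i)) // leq_mul2l DD orbT.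
Qed.

Lemma spanned1 : spanned 0 1.
Proof.
exists [:: (1, e0)].
  by rewrite lincomb_cons lincomb_nil /= rmorph1 mul1r b0 addr0 subrr idealr0.
by move=> y; rewrite inE => /eqP->; split; case: Sf.
Qed.

Lemma spannedM D D' x y : spanned D x -> spanned D' y -> spanned (D + D') (x * y).
Proof.
have [_ SG SD _] := Sf.
move=> [r xr hr] [r' yr hr'].
exists [seq (u.1 * v.1, u.2 +e v.2) | u <- r, v <- r'].
  have -> : lincomb k b [seq (u.1 * v.1, u.2 +e v.2) | u <- r, v <- r']
          = lincomb k b r * lincomb k b r'.
    rewrite /lincomb big_allpairs_dep /= mulr_suml; apply: eq_big_seq => u ur.
    rewrite mulr_sumr; apply: eq_big_seq => v vr.
    rewrite (bM (SG _ (hr _ ur).1) (SG _ (hr' _ vr).1)) rmorphM.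
    by rewrite mulrACA.
  rewrite (_ : _ - _ = x * (y - lincomb k b r') + lincomb k b r' * (x - lincomb k b r)); last by ring.
  by rewrite rpredD // idealMr.
move=> z /allpairsP[[u v] /= [ur vr ->]] /=.
have [su hu] := hr _ ur; have [sv hv] := hr' _ vr.
split=> [|i]; first exact: SD.
have := hu i; have := hv i; rewrite mulnDr.
by move: (c * D)%N (c * D')%N (u.2 i) (v.2 i) => x1 x2 x3 x4; lia.
Qed.

Lemma spannedX D x n' : spanned D x -> spanned (D * n') (x ^+ n').
Proof.
move=> h; elim: n' => [|n' IH]; first by rewrite muln0 expr0; apply: spanned1.
by rewrite exprS mulnS; apply: spannedM.
Qed.

Lemma spanned_mexp F a : size F = size a -> (forall x, x \in F -> spanned 1 x) ->
  spanned (sumn a) (mexp F a).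
Proof.
elim: F a => [|f F IH] [|d a] //=.
  by move=> _ _; rewrite /mexp big_nil; apply: spanned1.
move=> [sz] hF; rewrite mexp_cons; apply: spannedM.
  by have := spannedX d (hF _ (mem_head _ _)); rewrite mul1n.
by apply: IH => // x xF; apply: hF; rewrite inE xF orbT.
Qed.

End Bounded.

(** If n < m, the monomials in m independent elements grow like N^m, whereas modulo [q] they lie in
    a space of dimension O(N^r) with r at most n. *)
Lemma chain_bound : (m <= n)%N.
Proof.
rewrite leqNgt; apply/negP => nm.
have /choice[f hf] : forall i : nat, exists x,
    (i < m)%N -> x \in P i.+1 /\ x \notin P i.
  move=> i; have [im|] := ltnP i m; last by exists 0.
  have ii : (@inord m i < @inord m i.+1)%N by rewrite !inordK // ltnS ltnW.
  have [_ h] := pc ii; apply: contrapT => h'; apply: h => x xi.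
  by apply/negPn/negP => xn; apply: h'; exists x.
have /choice[rho hrho] : forall i : nat, exists r, f i = lincomb k b r.
  by move=> i; apply: bgen.
pose M := [seq e <- flatten [seq unzip2 (rho i) | i <- iota 0 m]
          | `[< G e >] && (b e \notin q)].
have MG e : e \in M -> G e /\ b e \notin q.
  by rewrite mem_filter => /andP[/andP[/asboolP]].
have [S [r [J [rn Sf SM Jinj]]]] := cone (expo_sum_notin MG).1.
have MS := expo_sum_face Sf MG SM.
pose c := (\sum_(e <- M) \sum_i absz (e i))%N.
have cM e i : e \in M -> (absz (e i) <= c)%N.
  move=> eM; rewrite /c (big_rem e) //= (bigD1 i) //= -addnA leq_addr //.
pose F := [seq f i | i <- iota 0 m].
have spF x : x \in F -> spanned S c 1 x.
  move=> /mapP[i]; rewrite mem_iota add0n => /= im ->.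
  exists [seq y <- rho i | y.2 \in M]; last first.
    move=> y; rewrite mem_filter => /andP[yM _]; split; first exact: MS.
    by move=> j; rewrite muln1 cM.
  rewrite hrho /lincomb big_filter (bigID (fun y => y.2 \in M)) /= [X in X - _]addrC addrK.
  rewrite big_seq_cond rpred_sum // => y /andP[yr yM]; rewrite idealMr //.
  have [/asboolP g|/asboolP/bN-> //] := boolP (`[< G y.2 >]); last exact: idealr0.
  move: yM; rewrite mem_filter asboolT //= negb_and negbK => /orP[//|/negP[]].
  apply/flattenP; exists (unzip2 (rho i)); last exact: map_f.
  by apply/mapP; exists i; rewrite // mem_iota.
(* [B0] is chosen so that 2D+1 is at most [B0 * N], and [N] exceeds [B0 ^ r], whence ([B0] N)^r <
   N^(r+1), which is at most N^m. *)
pose B0 := (2 * c * m + 1)%N; pose N := (B0 ^ r).+1.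
pose D := (c * (m * N))%N.
pose T := (m.-tuple 'I_N : finType).
pose C := ({ffun 'I_r -> 'I_(2 * D).+1} : finType).
(* The [N ^ m] monomials in the [f i] outnumber the available lattice points. *)
have cardTC : (#|C| < #|T|)%N.
  rewrite card_ffun !card_ord card_tuple card_ord.
  apply: (@leq_ltn_trans ((B0 * N) ^ r)).
    have hDN : ((2 * D).+1 <= B0 * N)%N.
      have N0 : (0 < N)%N by [].
      rewrite /D /B0; move: (N) N0 => N' N0; nia.
    by case: (r) => // r1; rewrite leq_exp2r.
  rewrite expnMn; apply: (@leq_trans (N ^ r.+1)); last by apply: leq_pexp2l => //; exact: leq_ltn_trans rn nm.
  by rewrite expnS ltn_mul2r expn_gt0 /= /N ltnSn.
pose ex (t : T) : seq nat := [seq val x | x <- t].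
have szF : size F = m by rewrite size_map size_iota.
have szex t : size (ex t) = m by rewrite size_map size_tuple.
have /choice[R hR] : forall t : T, exists r,
    mexp F (ex t) - lincomb k b r \in q /\ forall y, y \in r -> bounded S c (m * N) y.2.
  move=> t; have [|r0 h1 h2] := @spannedW S c (sumn (ex t)) (m * N) (mexp F (ex t)) _
    (spanned_mexp Sf (etrans szF (esym (szex t))) spF); last by exists r0.
  rewrite -(szex t) /ex; elim: (val t) => //= x s IH.
  by rewrite mulSn leq_add // ltnW.
(* Adding [D] moves the separating coordinates into the range from 0 to 2D. The inverse [dec] takes
   a dummy value at codes not attained. *)
pose code e : C := [ffun j => inord (absz (e (J j) + D%:Z))].
have codeI e1 e2 : bounded S c (m * N) e1 -> bounded S c (m * N) e2 ->
    code e1 = code e2 -> e1 = e2.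
  move=> [s1 h1] [s2 h2] /ffunP h; apply: Jinj => // j.
  have := congr1 val (h j); rewrite !ffunE /= !inordK //.
  - by have := h1 (J j); have := h2 (J j); rewrite /D; lia.
  - by have := h2 (J j); rewrite /D; lia.
  - by have := h1 (J j); rewrite /D; lia.
have /choice[dec hdec] : forall x : C, exists e,
    forall e', bounded S c (m * N) e' -> code e' = x -> e' = e.
  move=> x; have [[e [be ce]]|h] := pselect (exists e, bounded S c (m * N) e /\ code e = x).
    by exists e => e' be' ce'; apply: codeI => //; rewrite ce.
  by exists e0 => e' be' ce'; case: h; exists e'.
pose X := \matrix_(i < #|T|, j < #|C|)
  (\sum_(y <- R (enum_val i) | code y.2 == enum_val j) y.1).
have RX i : lincomb k b (R (enum_val i)) = \sum_j k (X i j) * b (dec (enum_val j)).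
  under eq_bigr => j _ do rewrite mxE rmorph_sum mulr_suml big_mkcond /=.
  rewrite exchange_big /= /lincomb; apply: eq_big_seq => y yr.
  rewrite (bigD1 (enum_rank (code y.2))) //= enum_rankK eqxx big1 ?addr0.
    by congr (_ * b _); apply: hdec => //; apply: (hR _).2 yr.
  move=> j jn; have /negbTE-> // : code y.2 != enum_val j.
  by apply: contraNneq jn => ->; rewrite enum_valK.
(* More rows than columns: a nonzero vector of the left kernel is a relation modulo [q] between the
   monomials in the [f i]. *)
have : kermx X != 0.
  rewrite kermx_eq0 -row_leq_rank -ltnNge.
  by rewrite (leq_ltn_trans (rank_leq_col X)).
case/rowV0Pn => u /sub_kermxP uX /negP[].
have lin0 : \sum_i k (u 0 i) * lincomb k b (R (enum_val i)) = 0.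
  under eq_bigr => i _ do rewrite RX mulr_sumr.
  rewrite exchange_big big1 //= => j _.
  under eq_bigr => i _ do rewrite mulrA -rmorphM.
  rewrite -mulr_suml -rmorph_sum /=.
  have := congr1 (fun w : 'rV[K]_(#|C|) => w 0 j) uX; rewrite !mxE => ->.
  by rewrite rmorph0 mul0r.
pose RR := [seq (u 0 i, ex (enum_val i)) | i <- enum 'I_(#|T|)].
have uq : lincomb k (mexp F) RR \in q.
  have -> : lincomb k (mexp F) RR
    = \sum_i k (u 0 i) * (mexp F (ex (enum_val i)) - lincomb k b (R (enum_val i))).
    under [RHS]eq_bigr => i _ do rewrite mulrBr.
    by rewrite sumrB lin0 subr0 /lincomb big_map big_enum.
  by rewrite rpred_sum // => i _; rewrite idealMr //; apply: (hR _).1.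
apply/eqP/rowP => i; rewrite mxE.
have <- : lincoef RR (ex (enum_val i)) = u 0 i.
  rewrite /lincoef big_map big_enum_cond /= (bigD1 i) //= big1 ?addr0 // => j /andP[/eqP ij /negP[]].
  apply/eqP/enum_val_inj/val_inj; exact: (inj_map val_inj ij).
apply: (chain_indep (P := fun i => p (inord i)) _ _ uq).
  move=> j; rewrite szF => jm; rewrite (nth_map 0%N) ?size_iota // nth_iota // add0n.
  have [h1 h2] := hf j jm; split=> //.
  have ii : (@inord m j < @inord m j.+1)%N by rewrite !inordK // ltnS ltnW.
  by have [] := pc ii.
by move=> y /mapP[j _ ->] /=; rewrite szex szF.
Qed.

End UpperBound.

End MonomialAlgebra.

(** * Tight sequences and minimal exponents *)

Lemma bigmax_mem (a : int) s : \big[Num.max/a]_(v <- s) v \in a :: s.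
Proof.
elim: s => [|v s IH]; first by rewrite big_nil mem_head.
rewrite big_cons; have [_|_] := leP v (\big[Num.max/a]_(v <- s) v).
  by move: IH; rewrite !inE => /orP[->|->] //; rewrite !orbT.
by rewrite !inE eqxx orbT.
Qed.

Lemma bigmax_ge (a : int) s v : v \in s -> v <= \big[Num.max/a]_(v <- s) v.
Proof.
elim: s => // w s IH; rewrite inE big_cons le_max => /predU1P[->|/IH ->].
  by rewrite lexx.
by rewrite orbT.
Qed.

Section Chains.
Variables (d : Order.disp_t) (H : finTBDistrLatticeType d).
Notation P := (jirr H).
Notation Pp := (pplus H).
Implicit Types (x y z : Pp) (t : nat) (nu eta : P -> int).

Lemma covered_lt x y : covered x y -> (x < y)%O.
Proof. by case/andP. Qed.

Lemma ext_add nu eta z : ext (fun a => nu a + eta a) z = ext nu z + ext eta z.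
Proof. by case: z => //=; rewrite addr0. Qed.

Lemma ext_sub nu eta z : ext (fun a => nu a - eta a) z = ext nu z - ext eta z.
Proof. by case: z => //=; rewrite subr0. Qed.

Lemma le_pinf x : (x <= pinf H)%O.
Proof. by case: x. Qed.

Lemma pinf_le x : (pinf H <= x)%O -> x = pinf H.
Proof. by case: x. Qed.

Lemma lt_pinf x y : (x < y)%O -> x <> pinf H.
Proof.
move=> xy xi; rewrite xi in xy.
by have yi := pinf_le (ltW xy); rewrite yi ltxx in xy.
Qed.

Lemma x0_le x : (Some (x0 H) <= x :> Pp)%O.
Proof. by case: x => // a; apply: (le0x (val a) : (x0 H <= a)%O). Qed.

Lemma sat_chainP x y t :
  reflect (exists z : seq Pp, [/\ size z = t, path (@covered _ H) x z & last x z = y])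
          (sat_chain x y t).
Proof.
apply: (iffP existsP) => [[z /andP[h /eqP l]]|[z [sz h l]]].
  by exists z; rewrite size_tuple.
by rewrite -sz; exists (in_tuple z); rewrite h l eqxx.
Qed.

Lemma sat_chain_refl x : sat_chain x x 0.
Proof. by apply/sat_chainP; exists [::]. Qed.

Lemma sat_chain_cover x y : covered x y -> sat_chain x y 1.
Proof. by move=> xy; apply/sat_chainP; exists [:: y]; rewrite /= xy. Qed.

Lemma sat_chain_cat x y z t t' :
  sat_chain x y t -> sat_chain y z t' -> sat_chain x z (t + t').
Proof.
move=> /sat_chainP[u [<- pu lu]] /sat_chainP[v [<- pv lv]].
by apply/sat_chainP; exists (u ++ v); rewrite size_cat cat_path last_cat lu pu pv.
Qed.

Lemma sat_chain_lt x y t : sat_chain x y t -> (t < #|{: Pp}|)%N.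
Proof.
move=> /sat_chainP[u [<- pu _]].
have : uniq (x :: u).
  apply: (@sorted_uniq _ <%O); [exact: lt_trans|exact: ltxx|].
  by apply: sub_path pu; exact: covered_lt.
by move=> /card_uniqP /= <-; exact: max_card.
Qed.

Lemma sat_chain_ex x y : (x <= y)%O -> exists t, sat_chain x y t.
Proof.
have [m] := ubnP #|[pred z | (x < z)%O && (z <= y)%O]|.
elim: m x y => // m IH x y hm xy.
have [->|nxy] := eqVneq x y; first by exists 0%N; apply: sat_chain_refl.
have ltxy : (x < y)%O by rewrite lt_neqAle nxy.
have [c|] := boolP (covered x y); first by exists 1%N; apply: sat_chain_cover.
rewrite /covered ltxy /= => /forallPn[z /negbNE/andP[xz zy]].
have [|t ht] := IH x z _ (ltW xz).
  rewrite -ltnS; apply: leq_trans hm; rewrite ltnS.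
  apply: proper_card; apply/properP; split.
    by apply/fintype.subsetP => w; rewrite !inE => /andP[-> wz]; rewrite (le_trans wz) ?ltW.
  by exists y; rewrite !inE ?ltxy ?lexx //= lt_geF.
have [|t' ht'] := IH z y _ (ltW zy).
  rewrite -ltnS; apply: leq_trans hm; rewrite ltnS.
  apply: proper_card; apply/properP; split.
    by apply/fintype.subsetP => w; rewrite !inE => /andP[zw ->]; rewrite (lt_trans xz).
  by exists z; rewrite !inE ?xz ?(ltW zy) //= ltxx.
by exists (t + t')%N; apply: sat_chain_cat ht'.
Qed.

Lemma Tset_chain (n : int) nu x y t : Tset n nu -> sat_chain x y t ->
  n * t%:Z <= ext nu x - ext nu y.
Proof.
move=> hn /sat_chainP[u [<- pu <-]] {y t}.
elim: u x pu => [|y u IH] x /=; first by rewrite mulr0 subrr.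
move=> /andP[xy /IH h]; have := hn _ _ xy; rewrite -addn1 PoszD mulrDr mulr1 => hx.
by rewrite -[leRHS](subrKA (ext nu y)) addrC lerD.
Qed.

Lemma qdist_ge (n : int) x y t : sat_chain x y t -> n * t%:Z <= qdist n x y.
Proof.
move=> h; apply: bigmax_ge; apply/mapP; exists t => //.
by rewrite mem_filter h mem_iota /= add0n (sat_chain_lt h).
Qed.

Lemma qdist_ex (n : int) x y : (x <= y)%O ->
  exists2 t, sat_chain x y t & qdist n x y = n * t%:Z.
Proof.
move=> /sat_chain_ex[t ht].
have : qdist n x y \in chain_values n x y.
  have : n * t%:Z \in chain_values n x y.
    by apply/mapP; exists t; rewrite // mem_filter ht mem_iota /= add0n (sat_chain_lt ht).
  (* The default of the maximum is the head of the list, so over a nonempty list the maximum is one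
     of its entries, whatever its sign. *)
  rewrite /qdist; case: (chain_values n x y) => // v s _.
  have := bigmax_mem v (v :: s).
  by rewrite /= inE => /predU1P[->|//]; rewrite mem_head.
by move=> /mapP[t']; rewrite mem_filter => /andP[h _] ->; exists t'.
Qed.

Lemma qdist_add (n : int) x y z : (x <= y)%O -> (y <= z)%O ->
  qdist n x y + qdist n y z <= qdist n x z.
Proof.
move=> /(qdist_ex n)[t ht ->] /(qdist_ex n)[t' ht' ->].
by rewrite -mulrDr -PoszD; apply: qdist_ge; apply: sat_chain_cat ht'.
Qed.

Lemma Tset_qdist (n : nat) (eps : int) nu x y : Tset (n%:Z * eps) nu ->
  (x <= y)%O -> n%:Z * qdist eps x y <= ext nu x - ext nu y.
Proof.
by move=> hn /(qdist_ex eps)[t ht ->]; rewrite mulrA; apply: Tset_chain hn ht.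
Qed.

Lemma Tset0_le nu x y : Tset 0 nu -> (x <= y)%O -> ext nu y <= ext nu x.
Proof.
move=> h0 xy; have := @Tset_qdist 0 0 nu x y; rewrite mul0r => /(_ h0 xy).
by rewrite mul0r subr_ge0.
Qed.

Lemma Tset0_ge0 nu (a : P) : Tset 0 nu -> 0 <= nu a.
Proof. by move=> h0; have := Tset0_le h0 (le_pinf (Some a)). Qed.

Lemma Tset0_x0 nu (a : P) : Tset 0 nu -> nu a <= nu (x0 H).
Proof. by move=> h0; have := Tset0_le h0 (x0_le (Some a)). Qed.

Definition tight (n : nat) (eps : int) nu (s : zseq H) : Prop :=
  forall i, (i <= size s)%N ->
    ext nu (xs s i) - ext nu (ys s i) = n%:Z * qdist eps (xs s i) (ys s i).

(** The exponents of minimal monomial generators: no monomial of the Hibi ring other than 1 can be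
    divided out. *)
Definition minimal (n : int) nu : Prop :=
  Tset n nu /\ forall eta, Tset 0 eta -> Tset n (fun a => nu a - eta a) ->
    forall a, eta a = 0.

Lemma ys_size (s : zseq H) : ys s (size s) = pinf H.
Proof. by rewrite /ys nth_default // size_map. Qed.

Lemma condN_le (s : zseq H) i : condN s -> (i <= size s)%N -> (xs s i <= ys s i)%O.
Proof.
move=> [_ _ h _]; rewrite leq_eqVlt => /predU1P[->|his].
  by rewrite ys_size; exact: le_pinf.
case: i his => [|i] his; first exact: x0_le.
by apply/ltW/h.
Qed.

(* An element [eta] of [Tset 0] with [nu - eta] in [Tset n] is constant on each
   tight pair, hence increases along the sequence up to its value at infinity. *)
Lemma tight_minimal (n : nat) (eps : int) nu (s : zseq H) :
  condN s -> Tset (n%:Z * eps) nu -> tight n eps nu s -> minimal (n%:Z * eps) nu.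
Proof.
move=> cs hn ht; split=> // eta h0 hne.
have hxy i : (i <= size s)%N -> ext eta (xs s i) <= ext eta (ys s i).
  move=> si; have := Tset_qdist hne (condN_le cs si).
  by rewrite -(ht _ si) !ext_sub; lia.
have hi i : (i <= size s)%N -> ext eta (xs s 0) <= ext eta (ys s i).
  elim: i => [|i IH] si; first exact: hxy.
  apply: le_trans (hxy _ si); apply: le_trans (IH (ltnW si)) _.
  by apply: Tset0_le => //; apply: ltW; case: cs => _ + _ _; apply.
move=> x; apply/eqP; rewrite eq_le Tset0_ge0 // andbT.
by apply: le_trans (Tset0_x0 x h0) _; have := hi _ (leqnn _); rewrite ys_size.
Qed.

(** * Routes from x_0 to infinity *)

Section Routes.
Variables (n : nat) (eps : int) (nu : P -> int).
Hypothesis hn : Tset (n%:Z * eps) nu.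

Definition tpair x y : Prop :=
  (x <= y)%O /\ ext nu x - ext nu y = n%:Z * qdist eps x y.

Definition route z t (u v : nat -> Pp) : Prop :=
  [/\ u 0%N = Some (x0 H), v t = z,
      forall i, (i <= t)%N -> tpair (u i) (v i)
    & forall i, (i < t)%N -> (u i.+1 <= v i)%O].

Lemma tpair_ge x y : (x <= y)%O -> ext nu x - ext nu y <= n%:Z * qdist eps x y ->
  tpair x y.
Proof. by move=> xy h; split=> //; apply/le_anti; rewrite h Tset_qdist. Qed.

Lemma tpair_cat x y z : tpair x y -> tpair y z -> tpair x z.
Proof.
move=> [xy h] [yz h']; apply: tpair_ge; first exact: le_trans yz.
have := ler_wpM2l (le0z_nat n) (qdist_add eps xy yz); rewrite mulrDr; lia.
Qed.

Lemma tpair_refl x : tpair x x.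
Proof.
apply: tpair_ge => //; rewrite subrr.
have := ler_wpM2l (le0z_nat n) (qdist_ge eps (sat_chain_refl x)).
by rewrite !mulr0.
Qed.

Lemma route_step z t u v x y : route z t u v -> (x <= z)%O -> tpair x y ->
  exists u' v', route y t.+1 u' v'.
Proof.
move=> [u0 vt ht hd] xz xy.
exists (fun i => if (i <= t)%N then u i else x), (fun i => if (i <= t)%N then v i else y).
split=> [|| i it | i it]; first by [].
- by rewrite ltnn.
- by case: leqP => [/ht|].
- rewrite ltnS in it; rewrite it; case: ltnP => ti; first exact: hd.
  by rewrite (_ : i = t) ?vt //; lia.
Qed.

(** There are four ways to shorten a route, each excluding one defect of the resulting sequence: a
    single tight climb from [u i] to [v j], a direct descent from [v i] to [u j], stopping at an
    early visit to infinity, and starting at a late visit to x_0. *)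
Lemma route_shortcut z t u v i j : route z t u v -> (i < j <= t)%N ->
  tpair (u i) (v j) -> exists u' v', route z (t - (j - i)) u' v'.
Proof.
move=> [u0 vt ht hd] /andP[ij jt] hij.
exists (fun k => if (k <= i)%N then u k else u (k + (j - i))%N),
       (fun k => if (k < i)%N then v k else v (k + (j - i))%N).
split=> [|| k kt | k kt]; first by [].
- by rewrite ltnNge (_ : (i <= _)%N) /=; [rewrite subnK //|]; lia.
- case: (ltngtP k i) => ki; first by apply: ht; lia.
    by apply: ht; lia.
  by rewrite ki (_ : (i + _)%N = j) //; lia.
- case: (ltnP k i) => ki; first by apply: hd; lia.
  by rewrite addSn; apply: hd; lia.
Qed.

Lemma route_skip z t u v i j : route z t u v -> (i.+2 <= j <= t)%N ->
  (u j <= v i)%O -> exists u' v', route z (t - (j - i.+1)) u' v'.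
Proof.
move=> [u0 vt ht hd] /andP[ij jt] hij.
exists (fun k => if (k <= i)%N then u k else u (k + (j - i.+1))%N),
       (fun k => if (k <= i)%N then v k else v (k + (j - i.+1))%N).
split=> [|| k kt | k kt]; first by [].
- by rewrite leqNgt (_ : (i < _)%N) /=; [rewrite subnK //|]; lia.
- by case: leqP => ki; apply: ht; lia.
- case: (ltngtP k i) => ki; first by apply: hd; lia.
    by rewrite addSn; apply: hd; lia.
  by rewrite ki (_ : (i.+1 + _)%N = j) //; lia.
Qed.

Lemma route_take z t u v i : route z t u v -> (i <= t)%N -> route (v i) i u v.
Proof.
move=> [u0 vt ht hd] it; split=> // k ki; first by apply: ht; lia.
by apply: hd; lia.
Qed.

Lemma route_drop z t u v i : route z t u v -> (i <= t)%N -> u i = Some (x0 H) ->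
  exists u' v', route z (t - i) u' v'.
Proof.
move=> [u0 vt ht hd] it ui.
exists (fun k => u (k + i)%N), (fun k => v (k + i)%N); split=> [|| k kt | k kt] //.
- by rewrite subnK.
- by apply: ht; lia.
- by rewrite addSn; apply: hd; lia.
Qed.

(* The elements from which a route can descend form an order ideal; subtracting
   its indicator function would keep [nu] in [Tset n]. *)
Lemma minimal_route :
  (forall eta, Tset 0 eta -> Tset (n%:Z * eps) (fun a => nu a - eta a) ->
    forall a, eta a = 0) ->
  exists t u v, route (pinf H) t u v.
Proof.
move=> hmin; apply: contrapT => hno.
pose U z := `[< exists z' t u v, (z <= z')%O /\ route z' t u v >].
have Uinf : U (pinf H) = false.
  apply/asboolP => -[z' [t [u [v [/pinf_le -> h]]]]].
  by apply: hno; exists t, u, v.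
have Ux0 : U (Some (x0 H)).
  apply/asboolP; exists (Some (x0 H)), 0%N, (fun=> Some (x0 H)), (fun=> Some (x0 H)).
  by split=> //; split=> // i _; apply: tpair_refl.
have Udown z z' : (z <= z')%O -> U z' -> U z.
  move=> zz /asboolP[z2 [t [u [v [h1 h2]]]]]; apply/asboolP.
  by exists z2, t, u, v; split=> //; apply: le_trans h1.
pose eta (a : P) : int := (U (Some a))%:Z.
have extE z : ext eta z = (U z)%:Z by case: z => //=; rewrite Uinf.
suff : eta (x0 H) = 0 by rewrite /eta Ux0.
apply: hmin => z z' zz'; have lzz := covered_lt zz'.
  by rewrite !extE; have := Udown _ _ (ltW lzz); case: (U z); case: (U z') => // ->.
rewrite !ext_sub !extE; have h := hn zz'.
have [Uz'|/negbTE Uz'] := boolP (U z').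
  by rewrite (Udown _ _ (ltW lzz) Uz') opprB addrA subrK.
rewrite subr0; have [Uz|/negbTE Uz] := boolP (U z); last by rewrite subr0.
rewrite addrAC lerBrDr lezD1 lt_neqAle h andbT.
(* Equality would make this cover tight and extend a route to [z'], which lies outside the ideal; so
   the inequality is strict and survives subtracting 1. *)
apply: contraFneq Uz' => e; move/asboolP: Uz => [w [t [u [v [zw hr]]]]].
have [|u' [v' hr']] := route_step (y := z') hr zw.
  apply: tpair_ge; rewrite ?(ltW lzz) // -e -[eps in leLHS]mulr1.
  by rewrite ler_wpM2l // (qdist_ge eps (sat_chain_cover zz')).
by apply/asboolP; exists z', t.+1, u', v'.
Qed.

(** The right-hand side is [qalt] with differences of [nu] in place of [qdist], which makes
    reducedness comparable with tightness. *)
Lemma route_telescope (u v : nat -> Pp) i j : (i <= j)%N ->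
  ext nu (u i) - ext nu (v j)
  = \sum_(i <= l < j.+1) (ext nu (u l) - ext nu (v l))
    - \sum_(i.+1 <= l < j.+1) (ext nu (u l) - ext nu (v l.-1)).
Proof.
elim: j => [|j IH]; rewrite leq_eqVlt => /predU1P[->|ij].
- by rewrite big_nat1 big_geq // subr0.
- by [].
- by rewrite big_nat1 big_geq // subr0.
- rewrite big_nat_recr 1?ltnW //= [X in _ = _ - X]big_nat_recr //=.
  by rewrite opprD addrACA -(IH ij) /=; ring.
Qed.

(* A route of minimal length cannot be shortened, which yields condition N and
   [eps]-reducedness. *)
Lemma minimal_tight :
  (forall eta, Tset 0 eta -> Tset (n%:Z * eps) (fun a => nu a - eta a) ->
    forall a, eta a = 0) ->
  exists2 s, Nseq eps s & tight n eps nu s.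
Proof.
move=> hmin.
have exr : exists t, `[< exists u v, route (pinf H) t u v >].
  by have [t h] := minimal_route hmin; exists t; apply/asboolP.
case: (ex_minnP exr) => t /asboolP[u [v hr]] hm.
have {}hm t' u' v' : route (pinf H) t' u' v' -> (t <= t')%N.
  by move=> h; apply: hm; apply/asboolP; exists u', v'.
have [u0 vt ht hd] := hr.
have vinf i : (i < t)%N -> v i <> pinf H.
  move=> it vi; have := route_take hr (ltnW it); rewrite vi => /hm; lia.
have nocut i j : (i < j <= t)%N -> ~ tpair (u i) (v j).
  by move=> ij /(route_shortcut hr ij)[u' [v' /hm]]; lia.
have noskip i j : (i.+2 <= j <= t)%N -> ~~ (u j <= v i)%O.
  by move=> ij; apply/negP => /(route_skip hr ij)[u' [v' /hm]]; lia.
(* If [u i.+1] equals [v i], two consecutive climbs merge into one. *)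
have hlt i : (i < t)%N -> (u i.+1 < v i)%O.
  move=> it; rewrite lt_neqAle hd // andbT; apply/eqP => e.
  apply: (@nocut i i.+1); first by rewrite ltnSn.
  by have := ht _ it; rewrite e; apply: tpair_cat; apply: ht; exact: ltnW.
(* If [u i] equals [v i], two consecutive descents merge, bypassing the trivial climb. *)
have hlt2 i : (0 < i < t)%N -> (u i < v i)%O.
  case: i => // i /= it; rewrite lt_neqAle (ht _ (ltnW it)).1 andbT; apply/eqP => e.
  have /noskip/negP[] : (i.+2 <= i.+2 <= t)%N by rewrite leqnn.
  by apply: le_trans (hd _ it) _; rewrite -e; apply: hd; exact: ltnW.
have unb i : (i < t)%N -> u i.+1 <> Some (x0 H).
  by move=> it /(route_drop hr it)[u' [v' /hm]]; lia.
pose un (o : Pp) : P := odflt (x0 H) o.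
pose s : zseq H := mkseq (fun i => (un (v i), un (u i.+1))) t.
have szs : size s = t by rewrite size_mkseq.
have ysE i : (i <= t)%N -> ys s i = v i.
  rewrite leq_eqVlt => /predU1P[->|it]; first by rewrite -{1}szs ys_size vt.
  rewrite /ys (nth_map (x0 H, x0 H)) ?szs // nth_mkseq //=.
  by have := vinf i it; case: (v i).
have xsE i : (i <= t)%N -> xs s i = u i.
  case: i => [|i] it; first by rewrite u0.
  rewrite /xs /= (nth_map (x0 H, x0 H)) ?szs // nth_mkseq //=.
  by have := lt_pinf (hlt i it); case: (u i.+1).
exists s; last by move=> i; rewrite szs => it; rewrite xsE // ysE //; apply: (ht _ it).2.
split; first split; rewrite ?szs.
- move=> p /mapP[i]; rewrite mem_iota add0n => /= it -> /=.
  have := unb i it; have := lt_pinf (hlt i it); have := hlt i it; have := vinf i it.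
  case: (v i) => // a _; case: (u i.+1) => //= c ca _ cx; split; last first.
    by apply/eqP => e; apply: cx; rewrite e.
  by apply/eqP => ax; move: ca; rewrite ax => /lt_geF; rewrite x0_le.
- by move=> i it; rewrite xsE // ysE ?hlt // ltnW.
- by move=> i /andP[i0 it]; rewrite xsE ?ysE ?hlt2 ?i0 // ltnW.
- by move=> i j ij; rewrite xsE ?ysE ?noskip //; lia.
move=> i j; rewrite szs => ij; have it : (i <= t)%N by lia.
have jt : (j <= t)%N by lia.
(* Climbs are equalities and descents inequalities in the telescoping sum, so a failure of
   reducedness would make the pair from [u i] to [v j] tight and allow a shortcut. *)
rewrite xsE // ysE // => xy; rewrite ltNge; apply/negP => hq.
apply: (nocut i j ij); apply: tpair_ge => //.
apply: le_trans (ler_wpM2l (le0z_nat n) hq).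
rewrite (route_telescope u v (_ : (i <= j)%N)); last by lia.
rewrite /qalt mulrBr !mulr_sumr; apply: lerB.
  rewrite big_nat [leRHS]big_nat; apply: ler_sum => l hl.
  by rewrite xsE ?ysE ?(ht l _).2 //; lia.
rewrite big_nat [leRHS]big_nat; apply: ler_sum => l hl.
rewrite xsE ?ysE; try lia.
apply: Tset_qdist => //; case: l hl => // l hl; apply: hd; lia.
Qed.

End Routes.
End Chains.

(** * Monomial fractional ideals of the Hibi ring *)

Section MonomialModules.
Variables (K : fieldType) (d : Order.disp_t) (H : finTBDistrLatticeType d).
Notation P := (jirr H).
Notation Pp := (pplus H).
Notation L := (ambient K H).
Notation kc := (@lconst K P).
Notation hibi := (hibi K H).
Implicit Types (nu mu eta : P -> int) (M : set (P -> int)) (r : seq (K * (P -> int))).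
Implicit Types (f g : L).

Lemma TsetD (m n : int) nu mu : Tset m nu -> Tset n mu ->
  Tset (m + n) (fun a => nu a + mu a).
Proof.
move=> hm hn z z' zz; rewrite !ext_add opprD addrACA.
by apply: lerD; [exact: hm|exact: hn].
Qed.

Lemma Tset0_0 : Tset 0 (fun _ : P => 0).
Proof. by move=> z z' _; case: z; case: z'. Qed.

(** Has the shape of the definition of [omega], so that [omega] is [Kspan (Tset 1)] by
    conversion. *)
Definition Kspan M : set L := modgen (range (kconst K H)) (@Tmon K d H @` M).

Lemma Kspan0 M : Kspan M 0.
Proof. by case: (submod_modgen (range (kconst K H)) (@Tmon K d H @` M)). Qed.

Lemma KspanB M f g : Kspan M f -> Kspan M g -> Kspan M (f - g).
Proof. by case: (submod_modgen (range (kconst K H)) (@Tmon K d H @` M)) => _ + _; apply. Qed.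

Lemma KspanD M f g : Kspan M f -> Kspan M g -> Kspan M (f + g).
Proof.
by move=> hf hg; rewrite -[g]opprK; apply: KspanB => //; rewrite -sub0r;
  apply: KspanB => //; exact: Kspan0.
Qed.

Lemma KspanP M f :
  Kspan M f <-> exists2 r, f = lincomb kc (@lmon K P) r & forall p, p \in r -> M p.2.
Proof.
split=> [|[r -> hr]].
  apply: (modgen_min (M := [set f | exists2 r, f = lincomb kc (@lmon K P) r
                                       & forall p, p \in r -> M p.2])).
    split=> [|f1 f2 [r1 -> h1] [r2 -> h2]|_ _ [c _ <-] [r -> hr]].
    - by exists [::]; rewrite ?lincomb_nil.
    - exists (r1 ++ lincomb_neg r2); first by rewrite lincomb_cat lincomb_opp.
      move=> p; rewrite mem_cat => /orP[/h1//|/mapP[q /h2 hq ->]] //.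
    - exists [seq (c * p.1, p.2) | p <- r]; last by move=> p /mapP[q /hr hq ->].
      rewrite /lincomb big_map mulr_sumr; apply: eq_bigr => p _ /=.
      by rewrite rmorphM mulrA.
  move=> _ [nu Mnu <-]; exists [:: (1, nu)]; last by move=> p; rewrite inE => /eqP->.
  by rewrite lincomb_cons lincomb_nil /= rmorph1 mul1r addr0.
rewrite /lincomb big_seq; apply: (big_ind (Kspan M)) => [||p /hr Mp].
- exact: Kspan0.
- exact: KspanD.
have [_ _ hZ] := submod_modgen (range (kconst K H)) (@Tmon K d H @` M); apply: hZ; first by exists p.1.
by move=> S [_]; apply; exists p.2.
Qed.

Lemma Kspan_lincomb M r : (forall p, p \in r -> M p.2) -> Kspan M (lincomb kc (@lmon K P) r).
Proof. by move=> hr; apply/KspanP; exists r. Qed.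

Lemma Kspan_mon M nu : M nu -> Kspan M (Tmon K nu).
Proof. by move=> h S [_]; apply; exists nu. Qed.

Lemma Kspan_coef M r e : Kspan M (lincomb kc (@lmon K P) r) -> lincoef r e != 0 -> M e.
Proof.
move=> /KspanP[r' rr hr'] ce.
have [/mapP[p pr ->]|/lincoef_notin c0] := boolP (e \in unzip2 r'); first exact: hr'.
have := @lmon_indep K P (r ++ lincomb_neg r') e.
rewrite lincomb_cat lincomb_opp -rr subrr lincoef_cat lincoef_opp c0 subr0 => /(_ erefl) h.
by rewrite h eqxx in ce.
Qed.

Lemma coef_Kspan M r : (forall e, lincoef r e != 0 -> M e) -> Kspan M (lincomb kc (@lmon K P) r).
Proof.
have [r' [<- hc hr']] := lincomb_reduce kc (@lmon K P) r => hM.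
by apply: Kspan_lincomb => p /hr'[p1 p0]; apply: hM; rewrite -p1.
Qed.

Lemma KspanM M1 M2 M3 f g : (forall nu mu, M1 nu -> M2 mu -> M3 (fun a => nu a + mu a)) ->
  Kspan M1 f -> Kspan M2 g -> Kspan M3 (f * g).
Proof.
move=> hM /KspanP[r -> hr] /KspanP[r' -> hr']; apply/KspanP.
exists [seq (p.1 * q.1, fun a => p.2 a + q.2 a) | p <- r, q <- r'].
  rewrite /lincomb big_allpairs_dep /= mulr_suml; apply: eq_bigr => p _.
  by rewrite mulr_sumr; apply: eq_bigr => q _; rewrite lmonD rmorphM mulrACA.
by move=> _ /allpairsP[[p q] /= [pr qr ->]] /=; apply: hM; [exact: hr|exact: hr'].
Qed.

Lemma Kspan_const c : Kspan (Tset 0) (kconst K H c).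
Proof.
apply/KspanP; exists [:: (c, fun=> 0)].
  by rewrite lincomb_cons lincomb_nil /= lmon0 mulr1 addr0.
by move=> p; rewrite inE => /eqP-> /=; apply: Tset0_0.
Qed.

Lemma TmonD nu mu : Tmon K (fun a => nu a + mu a) = Tmon K nu * Tmon K mu.
Proof. exact: lmonD. Qed.

Definition ideal_ind (I : {set P}) (a : P) : int := (a \in I)%:Z.

Lemma Tmon_ind (I : {set P}) : Tmon K (ideal_ind I) = \prod_(x in I) Tvar K x.
Proof.
rewrite /Tmon [RHS]big_mkcond; apply: eq_bigr => x _.
by rewrite /ideal_ind; case: (x \in I).
Qed.

Lemma Tset0_ind (I : {set P}) :
  (forall x y, y \in I -> (x <= y)%O -> x \in I) -> Tset 0 (ideal_ind I).
Proof.
move=> hI z z' /covered_lt; case: z => [x|]; last by move=> /lt_pinf.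
case: z' => [y|] xy /=.
  have := hI x y; rewrite /ideal_ind; case: (y \in I) => [h|_].
    by rewrite h // (ltW xy : (x <= y)%O).
  by rewrite subr0.
by rewrite subr0.
Qed.

(** The support of a nonzero exponent in [Tset 0] is a nonempty down-closed set. Subtracting its
    indicator stays in [Tset 0] and lowers the total, so the monomial is a product of generators. *)
Lemma hibiE : hibi = Kspan (Tset 0).
Proof.
apply/seteqP; split.
  apply: smallest_sub.
    split; [exact: Kspan_const|by move=> u v; exact: KspanB|].
    by move=> u v; apply: KspanM => nu mu h1 h2; rewrite -(addr0 0); apply: TsetD.
  move=> _ [I [_ hI] ->]; rewrite -Tmon_ind; apply: Kspan_mon; exact: Tset0_ind.
have [hc _ hM] := hibiP K H.
apply: modgen_min.
  case: (hibi_submod K H) => h0 hB _; split=> // _ v [c _ <-]; exact: hM.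
move=> _ [nu h0 <-].
have [m] := ubnP (\sum_(a : P) absz (nu a))%N.
elim: m nu h0 => // m IH nu h0 hm.
have [n0|/existsNP[a /eqP na]] := pselect (forall a, nu a = 0).
  rewrite (_ : nu = fun=> 0) ?[Tmon _ _]lmon0; first exact: hibi1.
  by apply/funext.
pose I : {set P} := finset (fun x => 0 < nu x).
have hI x y : y \in I -> (x <= y)%O -> x \in I.
  rewrite !inE => y0 xy; apply: (lt_le_trans y0).
  exact: (Tset0_le h0 (xy : (Some x <= Some y :> Pp)%O)).
have hnI : Tset 0 (fun a => nu a - ideal_ind I a).
  move=> z z' zz; rewrite !ext_sub.
  have ge0 w : 0 <= ext nu w by case: w => //= b; exact: Tset0_ge0.
  have extI w : ext (ideal_ind I) w = Posz (0 < ext nu w)%R.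
    by case: w => //= b; rewrite /ideal_ind inE.
  have aux (p q : int) : 0 <= p -> 0 <= q -> 0 <= p - q ->
    0 <= p - Posz (0 < p)%R - (q - Posz (0 < q)%R) by lia.
  by rewrite !extI; apply: aux => //; apply: h0.
have -> : nu = fun a => ideal_ind I a + (nu a - ideal_ind I a).
  by apply/funext => b; rewrite addrC subrK.
have aI : a \in I by rewrite inE lt_neqAle eq_sym na Tset0_ge0.
rewrite TmonD; apply: hM.
  rewrite Tmon_ind => S [_]; apply; exists I => //; split=> //.
  by apply/set0Pn; exists a.
apply: IH => //; rewrite ltnS in hm; apply: leq_trans hm.
have hb b : (absz (nu b - ideal_ind I b) <= absz (nu b))%N.
  by rewrite /ideal_ind inE; have := Tset0_ge0 b h0; lia.
rewrite (bigD1 a) // [in X in (_ <= X)%N](bigD1 a) //=.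
rewrite -addSn leq_add ?leq_sum //.
by move: aI; rewrite /ideal_ind inE => ->; have := Tset0_ge0 a h0; lia.
Qed.

Definition T0stable M := forall nu mu, Tset 0 nu -> M mu -> M (fun a => nu a + mu a).

Lemma Kspan_submod M : T0stable M -> submod hibi (Kspan M).
Proof.
move=> hM; split; [exact: Kspan0|exact: KspanB|].
by rewrite hibiE => a u; apply: KspanM.
Qed.

Lemma idmul_Kspan M1 M2 M3 : T0stable M3 ->
  (forall nu mu, M1 nu -> M2 mu -> M3 (fun a => nu a + mu a)) ->
  (forall nu, M3 nu -> exists mu, M1 mu /\ M2 (fun a => nu a - mu a)) ->
  idmul (Kspan M1) (Kspan M2) = Kspan M3.
Proof.
move=> hM h12 h3; apply/seteqP; split.
  by apply: idmul_rec => [|a c]; [exact: Kspan_submod|exact: KspanM].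
apply: modgen_min.
  case: (submod_idmul (Kspan M1) (Kspan M2)) => i0 iB iM.
  split=> // _ u [c _ <-]; apply: iM; rewrite hibiE; exact: Kspan_const.
move=> _ [nu /h3[mu [h1 h2]] <-].
have -> : nu = fun a => mu a + (nu a - mu a) by apply/funext => a; rewrite addrC subrK.
by rewrite TmonD; apply: idmul_in; apply: Kspan_mon.
Qed.

Lemma Tset_stable (n : int) : T0stable (Tset n).
Proof. by move=> nu mu h0 hn; rewrite -(add0r n); apply: TsetD. Qed.

(** Both m -> floor(m/N) and m -> m - floor(m/N) are nondecreasing, and adding N eps to m adds eps
    and (N-1) eps to them. This is why ordinary powers already contain every monomial of
    [Tset (n * eps)]. *)
Lemma divz_split (N m m' : int) eps : 0 < N -> m - m' >= N * eps ->
  (m %/ N)%Z - (m' %/ N)%Z >= eps /\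
  (m - (m %/ N)%Z) - (m' - (m' %/ N)%Z) >= (N - 1) * eps.
Proof.
move=> N0 h.
have e1 := divz_eq m N; have e2 := divz_eq m' N.
have := ltz_pmod m N0; have := ltz_pmod m' N0.
have := modz_ge0 m (lt0r_neq0 N0); have := modz_ge0 m' (lt0r_neq0 N0).
move: e1 e2; set a := (m %/ N)%Z; set a' := (m' %/ N)%Z.
set c := (m %% N)%Z; set c' := (m' %% N)%Z => e1 e2 h1 h2 h3 h4.
have h5 : eps <= a - a' by nia.
by split=> //; nia.
Qed.

Lemma idpow_Kspan (eps : int) n :
  idpow (Kspan (Tset eps)) n = Kspan (Tset (n%:Z * eps)).
Proof.
elim: n => [|n IH]; first by rewrite mul0r /= hibiE.
rewrite /= IH; apply: idmul_Kspan; first exact: Tset_stable.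
  by move=> nu mu h1 h2; rewrite -addn1 addnC PoszD mulrDl mul1r; apply: TsetD.
move=> nu hn; exists (fun a => nu a %/ n.+1%:Z)%Z.
have extd z : ext (fun a => nu a %/ n.+1%:Z)%Z z = (ext nu z %/ n.+1%:Z)%Z.
  by case: z => //=; rewrite div0z.
split=> z z' /hn/divz_split-/(_ isT)[h1 h2]; first by rewrite !extd.
by rewrite !ext_sub !extd (_ : n%:Z = n.+1%:Z - 1) //; lia.
Qed.

Definition nonzero0 : set (P -> int) := [set eta | Tset 0 eta /\ eta (x0 H) <> 0].

Lemma irrelevantE : irrelevant K H = Kspan nonzero0.
Proof.
have st : T0stable nonzero0.
  move=> nu mu h0 [h1 h2]; split; first by rewrite -(addr0 0); apply: TsetD.
  by have := Tset0_ge0 (x0 H) h0; have := Tset0_ge0 (x0 H) h1; lia.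
apply/seteqP; split; apply: modgen_min.
- exact: Kspan_submod.
- move=> f [+ [n n0 [p fp hp]]].
  rewrite hibiE => fT; have /KspanP[r fr hr] := fT; rewrite fr; apply: coef_Kspan => e ce.
  have eT : Tset 0 e by apply: (Kspan_coef (r := r)) => //; rewrite -fr.
  split=> // e0.
  (* Homogeneity speaks of a polynomial representing [f]; its terms are matched with those of [r]
     through independence of Laurent monomials. *)
  pose ex (m : 'X_{1..#|{: P}|}) : P -> int := fun a => (m (enum_rank a))%:Z.
  pose r' := [seq (p@_m, ex m) | m <- msupp p].
  have fr' : f = lincomb kc (@lmon K P) r'.
    rewrite fp {1}(mpolyE p) rmorph_sum /lincomb [RHS]big_map; apply: eq_bigr => m _ /=.
    rewrite -mul_mpolyC rmorphM /=; congr (_ * _).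
    rewrite (lmon_nat K (fun a => m (enum_rank a))); congr (FracField.tofrac 'X_[_]).
    by apply/mnmP => i; rewrite mnmE enum_valK.
  have := @lmon_indep K P (r ++ lincomb_neg r') e.
  rewrite lincomb_cat lincomb_opp -fr -fr' subrr lincoef_cat lincoef_opp => /(_ erefl)/eqP.
  rewrite subr_eq0 => /eqP cc; rewrite cc in ce.
  have [/mapP[[c e'] /mapP[m mp [_ ->]] /= ee]|/lincoef_notin c0] := boolP (e \in unzip2 r').
    by move: e0; rewrite ee /ex hp // => -[n00]; rewrite n00 in n0.
  by rewrite c0 eqxx in ce.
- case: (submod_modgen hibi [set f | hibi f /\ exists2 n, (0 < n)%N & homogeneous n f]).
  by move=> i0 iB iM; split=> // _ u [c _ <-]; apply: iM; rewrite hibiE; exact: Kspan_const.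
- move=> _ [nu [h0 h1] <-] S [_]; apply; split.
    by rewrite hibiE; apply: Kspan_mon.
  exists (absz (nu (x0 H))); first by lia.
  pose m := [multinom absz (nu (enum_val j)) | j < #|{: P}|].
  exists 'X_[m].
    rewrite -(lmon_nat K (fun a => absz (nu a))); congr (lmon K _).
    by apply/funext => a; rewrite gez0_abs // Tset0_ge0.
  by move=> m'; rewrite msuppX inE => /eqP->; rewrite mnmE enum_rankK.
Qed.

(* The exponents of the monomials of m J when J is spanned by [Tset n]. *)
Definition decomposable (n : int) : set (P -> int) :=
  [set nu | exists eta, nonzero0 eta /\ Tset n (fun a => nu a - eta a)].

Lemma idmul_irrelevant (n : int) :
  idmul (irrelevant K H) (Kspan (Tset n)) = Kspan (decomposable n).
Proof.
rewrite irrelevantE; apply: idmul_Kspan => //.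
- move=> nu mu h0 [eta [[e0 e1] h1]]; exists (fun a => nu a + eta a); split.
    split; first by rewrite -(addr0 0); apply: TsetD.
    by have := Tset0_ge0 (x0 H) h0; have := Tset0_ge0 (x0 H) e0; lia.
  rewrite (_ : (fun a => _) = fun a => mu a - eta a) //.
  by apply/funext => a; ring.
- move=> nu mu h1 h2; exists nu; split=> //.
  by rewrite (_ : (fun a => _) = mu) //; apply/funext => a; ring.
Qed.

(** A nonzero element of [Tset 0] is largest at x_0, hence of positive degree, so any nontrivial
    splitting is a splitting by an element of the irrelevant ideal. *)
Lemma minimalP (n : int) nu : Tset n nu -> ~ decomposable n nu -> minimal n nu.
Proof.
move=> h hd; split=> // eta h0 h1 a; apply/eqP/contraT => /eqP na.
case: hd; exists eta; split=> //; split=> // e0.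
by have := Tset0_x0 a h0; have := Tset0_ge0 a h0; rewrite e0; lia.
Qed.

Lemma minimalN (n : int) nu : minimal n nu -> ~ decomposable n nu.
Proof. by move=> [h hm] [eta [[h0 h1] h2]]; apply: h1; apply: hm. Qed.

Lemma shift_span M nu f : Kspan M (f * Tmon K nu) ->
  exists2 r, f = lincomb kc (@lmon K P) r & forall e, lincoef r e != 0 -> M (fun a => e a + nu a).
Proof.
move=> h; have /KspanP[r fr hr] := h.
have Tn0 : Tmon K nu != 0 by exact: lmon_neq0.
pose r' := [seq (p.1, fun a => p.2 a - nu a) | p <- r].
have fE : f = lincomb kc (@lmon K P) r'.
  apply: (mulIf Tn0); rewrite fr /lincomb big_map mulr_suml; apply: eq_bigr => p _ /=.
  rewrite -mulrA; congr (_ * _); rewrite -[RHS](lmonD K); congr lmon.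
  by apply/funext => a; rewrite subrK.
exists r' => // e ce; have [/mapP[_ /mapP[p pr ->] /= ->]|/lincoef_notin c0] := boolP (e \in unzip2 r').
  rewrite (_ : (fun a => _) = p.2); first exact: hr.
  by apply/funext => a; rewrite subrK.
by rewrite c0 eqxx in ce.
Qed.

Lemma shift_coef M nu r e : Kspan M (lincomb kc (@lmon K P) r * Tmon K nu) ->
  lincoef r e != 0 -> M (fun a => e a + nu a).
Proof.
move=> /shift_span[r' rr' hr'] ce; apply: hr'; move: ce.
have := @lmon_indep K P (r ++ lincomb_neg r') e.
by rewrite lincomb_cat lincomb_opp rr' subrr lincoef_cat lincoef_opp => /(_ erefl)/subr0_eq->.
Qed.

(** Testing against [mu] shows that [f] is a Laurent polynomial; testing against an exponent tight
    at a given cover yields the inequality at that cover. Conversely, [mu] in [Tset 0] provides the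
    denominator showing that [f] lies in the fraction field. *)
Lemma colon_Kspan (n : int) mu : Tset 0 mu -> Tset (- n) mu ->
  (forall z z' : Pp, covered z z' -> exists2 nu : P -> int, Tset (- n) nu
      & ext nu z - ext nu z' = - n) ->
  colon (Kspan (Tset (- n))) = Kspan (Tset n).
Proof.
move=> mu0 mun htight.
have hM f g : Kspan (Tset n) f -> Kspan (Tset (- n)) g -> hibi (f * g).
  rewrite hibiE; apply: KspanM => nu nu' h h'.
  by rewrite -(subrr n); apply: TsetD.
apply/seteqP; split=> f.
  case=> _ hf; have := hf _ (Kspan_mon mun); rewrite hibiE => /shift_span[r fr _].
  rewrite fr; apply: coef_Kspan => e ce z z' zz'.
  have [nu hnu nuzz] := htight _ _ zz'.
  have := hf _ (Kspan_mon hnu); rewrite hibiE fr => /shift_coef/(_ ce)/(_ _ _ zz').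
  by rewrite !ext_add opprD addrACA nuzz subr_ge0.
move=> hf; split; last by move=> a; apply: hM.
exists (f * Tmon K mu), (Tmon K mu); split.
- by apply: hM => //; apply: Kspan_mon.
- by rewrite hibiE; apply: Kspan_mon.
- exact: lmon_neq0.
- by rewrite mulfK //; exact: lmon_neq0.
Qed.

Lemma ext_norm (g : Pp -> int) z : ext (fun a => g (Some a) - g None) z = g z - g None.
Proof. by case: z => //=; rewrite subrr. Qed.

Lemma Tset_tight1 (z z' : Pp) : covered z z' ->
  exists2 nu : P -> int, Tset 1 nu & ext nu z - ext nu z' = 1.
Proof.
move=> zz'; have lzz := covered_lt zz'.
pose h (x : Pp) := #|[pred w : Pp | (w <= x)%O]|.
have h_lt x y : (x < y)%O -> (h x < h y)%N.
  move=> xy; apply: proper_card; apply/properP; split.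
    by apply/fintype.subsetP => w; rewrite !inE => /le_trans; apply; apply: ltW.
  by exists y; rewrite !inE ?lexx // lt_geF.
have h_gt0 x : (0 < h x)%N by apply/card_gt0P; exists x; rewrite inE lexx.
pose N := #|{: Pp}|.
have h_le x : (h x <= N)%N by exact: max_card.
(* Elements below [z'] other than [z] will get values at least [N]; that [N] is at least 2 keeps
   them a step above the value 1 of [z]. *)
have N2 : (1 < N)%N by apply: leq_trans (h_le z'); apply: leq_ltn_trans (h_lt _ _ lzz).
(* Minus the position in a linear extension with gaps, in which the elements below
   [z'] come first and [z], [z'] are consecutive. *)
pose g (x : Pp) : int := if x == z then 1 else if x == z' then 0 else
  if (x < z')%O then (2 * N)%:Z - (h x)%:Z else - (h x)%:Z.
exists (fun a => g (Some a) - g None); last first.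
  by rewrite !ext_norm /g !eqxx (gt_eqF lzz) opprB addrA subrK subr0.
move=> x y xy; rewrite !ext_norm opprB addrA subrK.
have lxy := covered_lt xy; have hxy := h_lt _ _ lxy.
have := h_gt0 x; have := h_le x; have := h_gt0 y; have := h_le y.
have nozz : ~~ ((z < y)%O && (y < z')%O).
  by case/andP: zz' => _ /forallP; apply.
rewrite /g; have [xz|nxz] := eqVneq x z.
  rewrite -xz in nozz *; rewrite (gt_eqF lxy); case: eqVneq => // yz' h1 h2 h3 h4.
  by rewrite lxy /= in nozz; rewrite (negbTE nozz); lia.
have [xz'|nxz'] := eqVneq x z'.
  have zy : (z < y)%O by apply: lt_trans lzz _; rewrite -xz'.
  rewrite (gt_eqF zy) -xz' (gt_eqF lxy) (lt_gtF lxy); lia.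
have [xlt|xnlt] := boolP (x < z')%O.
  by case: eqVneq => [_|_]; [lia|case: eqVneq => [_|_]; [lia|case: ifP; lia]].
have [yz|nyz] := eqVneq y z; first by rewrite (lt_trans lxy) // yz in xnlt.
have [yz|nyz'] := eqVneq y z'; first by rewrite -yz lxy in xnlt.
case: ifP => [yz|]; first by rewrite (lt_trans lxy) in xnlt.
lia.
Qed.

Lemma Tset_tightN1 (z z' : Pp) : covered z z' ->
  exists2 nu : P -> int, Tset (- 1) nu & ext nu z - ext nu z' = - 1.
Proof.
move=> zz'; have lzz := covered_lt zz'.
pose g (x : Pp) : int := - (x <= z)%O%:Z.
exists (fun a => g (Some a) - g None); last first.
  by rewrite !ext_norm opprB addrA subrK /g lexx (lt_geF lzz).
move=> x y xy; rewrite !ext_norm opprB addrA subrK /g.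
by case: (x <= z)%O; case: (y <= z)%O.
Qed.

(** This exponent makes the pair of x_0 and infinity tight, so the polytope of the empty sequence is
    nonempty; for [eps] equal to 1 it also lies in [Tset 0]. *)
Lemma Tset_depth (eps : int) : exists2 nu : P -> int, Tset eps nu
  & forall z, ext nu z = qdist eps z (pinf H).
Proof.
have q0 : qdist eps (pinf H) (pinf H) = 0.
  have [t /sat_chainP[u [<- pu lu]] ->] := qdist_ex eps (lexx (pinf H)).
  case: u pu lu => [|y u] /=; first by rewrite mulr0.
  by move=> /andP[/covered_lt/lt_geF]; rewrite le_pinf.
exists (fun a => qdist eps (Some a) (pinf H)).
  move=> z z' zz'; have := qdist_add eps (ltW (covered_lt zz')) (le_pinf z').
  have := qdist_ge eps (sat_chain_cover zz'); rewrite mulr1.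
  case: z {zz'} => [x|]; case: z' => [y|] /=; rewrite ?q0; lia.
by case=> //=; rewrite q0.
Qed.

Lemma Tset1_0 : exists2 mu : P -> int, Tset 0 mu & Tset 1 mu.
Proof.
have [mu h _] := Tset_depth 1; exists mu => // z z' /h; exact: le_trans.
Qed.

Lemma colon_omega : colon (Kspan (Tset 1)) = Kspan (Tset (- 1)).
Proof.
have [mu h0 h1] := Tset1_0.
rewrite -[1]opprK in h1 *; apply: (colon_Kspan h0 h1) => z z' /Tset_tight1.
by rewrite opprK.
Qed.

Lemma colon_Tset_N1 : colon (Kspan (Tset (- 1))) = Kspan (Tset 1).
Proof.
apply: (colon_Kspan Tset0_0); last exact: Tset_tightN1.
by move=> z z' _; case: z; case: z'.
Qed.

Lemma anticanonicalE : anticanonical K H = Kspan (Tset (- 1)).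
Proof.
have -> : anticanonical K H = divmul (colon (Kspan (Tset 1))) hibi by [].
rewrite colon_omega hibiE /divmul (idmul_Kspan (M3 := Tset (- 1))).
- by rewrite colon_Tset_N1 colon_omega.
- exact: Tset_stable.
- by move=> nu mu h1 h2; rewrite -(addr0 (- 1)); apply: TsetD.
- move=> nu h; exists nu; split=> //.
  by rewrite (_ : (fun a => _) = fun=> 0); [exact: Tset0_0|apply/funext => a; rewrite subrr].
Qed.

End MonomialModules.

(** * Lattice points and dimension of the polytopes *)

Section AffineHull.
Variables (R : fieldType) (V : vectType R).
Implicit Types (C X : set V).

Lemma affine_dim_ex C c : C c -> exists n, affine_dim C n.
Proof.
move=> Cc.
have ex : exists n, `[< exists2 U : {vspace V}, \dim U = n & forall v, C v -> v - c \in U >].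
  by exists (\dim {:V}); apply/asboolP; exists fullv => // v _; rewrite memvf.
case: (ex_minnP ex) => n /asboolP[U dU hU] hm; exists n, c => //; exists U; split=> // W hW.
have hUW v : C v -> v - c \in (U :&: W)%VS by move=> Cv; rewrite memv_cap hU ?hW.
have : (\dim U <= \dim (U :&: W))%N.
  by rewrite dU; apply: hm; apply/asboolP; exists (U :&: W)%VS.
move=> hd; have /eqP <- : (U :&: W == U)%VS by rewrite eqEdim capvSl.
exact: capvSr.
Qed.

Lemma affine_dim_le C n : affine_dim C n -> (n <= \dim {:V})%N.
Proof. by move=> [c _ [U [_ _ <-]]]; apply: dimvS; rewrite subvf. Qed.

Lemma free_spanning X : exists vs : seq V,
  [/\ free vs, forall v, v \in vs -> X v & forall v, X v -> v \in <<vs>>%VS].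
Proof.
have ex : exists n, `[< exists2 vs : seq V, size vs = n & free vs /\ forall v, v \in vs -> X v >].
  by exists 0%N; apply/asboolP; exists [::] => //; split=> //; apply: nil_free.
have bnd n : `[< exists2 vs : seq V, size vs = n & free vs /\ forall v, v \in vs -> X v >] ->
    (n <= \dim {:V})%N.
  by move=> /asboolP[vs <- [fv _]]; rewrite -(eqP fv); apply: dimvS; rewrite subvf.
case: (ex_maxnP ex bnd) => n /asboolP[vs sz [fv hX]] hm; exists vs; split=> // v Xv.
apply/contraT => nv; suff : (n.+1 <= n)%N by rewrite ltnn.
apply: hm; apply/asboolP; exists (v :: vs); first by rewrite /= sz.
split; first by rewrite free_cons nv.
by move=> w; rewrite inE => /predU1P[->|/hX].
Qed.

End AffineHull.

(** * Layer decomposition of a nonnegative function *)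

Section Layers.
Variables (R : realType) (T : finType).
Notation V := {ffun T -> R^o}.

(* [f] is the sum of its layers [f >= u], weighted by the gaps between the
   successive values [u] of [f]. *)
Lemma layer_span (W : {vspace V}) (f : V) : (forall x, 0 <= f x) ->
  (forall u : R, 0 < u -> [ffun x => ((u <= f x)%R : nat)%:R : R^o] \in W) -> f \in W.
Proof.
have [m] := ubnP #|[pred x | f x != 0]|.
elim: m f => // m IH f hm f0 hf.
have [/forallP h|/forallPn[x1 hx1]] := boolP [forall x, f x == 0].
  rewrite (_ : f = 0) ?mem0v //; apply/ffunP => x; rewrite ffunE; exact/eqP.
case: (@arg_minP _ _ _ x1 [pred x | f x != 0] f hx1) => x2 /= hx2 hmin.
have u0 : 0 < f x2 by rewrite lt_neqAle eq_sym hx2 f0.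
have hle x : f x != 0 -> f x2 <= f x by exact: hmin.
set u := f x2 in u0 hle.
pose L : V := [ffun x => ((u <= f x)%R : nat)%:R : R^o].
have fE x : (f - (u : R) *: L) x = if f x == 0 then 0 else f x - u.
  rewrite !ffunE; case: eqVneq => [->|/hle ->]; last by rewrite /GRing.scale /= mulr1.
  by rewrite leNgt u0 /= scaler0 subr0.
rewrite -[f](subrK ((u : R) *: L)) rpredD ?rpredZ ?hf //.
apply: IH.
- rewrite ltnS in hm; apply: leq_trans hm; apply: proper_card; apply/properP; split.
    apply/fintype.subsetP => x; rewrite !inE fE; have [e|//] := eqVneq (f x) 0.
    by rewrite eqxx.
  by exists x2; rewrite !inE ?hx2 // fE subrr; case: ifP; rewrite eqxx.
- by move=> x; rewrite fE; have [//|/hle] := eqVneq (f x) 0; rewrite subr_ge0.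
- move=> v v0; rewrite (_ : [ffun x => _] = [ffun x => ((u + v <= f x)%R : nat)%:R : R^o]).
    by apply: hf; rewrite addr_gt0.
  apply/ffunP => x; rewrite ffunE [RHS]ffunE fE; have [->|_] := eqVneq (f x) 0.
    by rewrite !leNgt v0 addr_gt0.
  by rewrite lerBrDl.
Qed.

End Layers.

(** * Integrality of the polytopes and independent lattice points *)

Section Polytope.
Variables (R : realType) (d : Order.disp_t) (H : finTBDistrLatticeType d).
Variables (eps : int) (s : zseq H).
Notation P := (jirr H).
Notation Pp := (pplus H).
Notation V := {ffun P -> R^o}.
Notation C := (polytope R eps s).
Implicit Types (nu : P -> int) (c : V) (n : nat).

(** The lattice points of n C written with integers only. The two notions agree once C has a point,
    which [dilated_lattice_point] presupposes even for n = 0. *)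
Definition cone n nu : Prop := Tset (n%:Z * eps) nu /\ tight n eps nu s.

Definition scaled n nu : V := [ffun a => (nu a)%:~R / n%:R].

Lemma ext_scaled n nu z : ext (scaled n nu) z = (ext nu z)%:~R / n%:R.
Proof. by case: z => [a|] /=; rewrite ?ffunE ?mul0r. Qed.

Lemma cone_scaled n nu : (0 < n)%N -> C (scaled n nu) <-> cone n nu.
Proof.
move=> n0; have n0' : (0 : R) < n%:R by rewrite ltr0n.
have eqE (a b' q : int) : (a%:~R / n%:R - b'%:~R / n%:R = q%:~R :> R) <-> a - b' = n%:Z * q.
  rewrite -mulrBl -rmorphB /=; split=> [/(canRL (divfK (lt0r_neq0 n0')))|->].
    by rewrite -[n%:R]/((n%:Z)%:~R) -intrM => /eqP; rewrite eqr_int mulrC => /eqP.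
  by rewrite intrM mulrC mulKf // lt0r_neq0.
have leE (a b' q : int) : (q%:~R <= a%:~R / n%:R - b'%:~R / n%:R :> R) = (n%:Z * q <= a - b').
  by rewrite -mulrBl -rmorphB /= ler_pdivlMr // -[n%:R]/((n%:Z)%:~R) -intrM ler_int mulrC.
split=> -[h1 h2]; split.
- by move=> z z' /h1; rewrite !ext_scaled leE.
- by move=> i /h2; rewrite !ext_scaled => /eqE.
- by move=> z z' /h1; rewrite !ext_scaled leE.
- by move=> i /h2 h; rewrite !ext_scaled; apply/eqE.
Qed.

Lemma dilated_cone n nu : dilated_lattice_point C n nu -> cone n nu.
Proof.
move=> [c [h1 h2] hc].
have hE z : (ext nu z)%:~R = n%:R * ext c z :> R.
  by case: z => [a|] /=; rewrite ?hc ?mulr0.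
split=> [z z' zz|i si].
  rewrite -(ler_int R) intrM rmorphB /= !hE -mulrBr.
  by apply: ler_wpM2l; [exact: ler0n|exact: h1].
apply/eqP; rewrite -(eqr_int R) intrM rmorphB /= !hE -mulrBr h2 //.
Qed.

Lemma cone_dilated n nu c : condN s -> C c -> cone n nu -> dilated_lattice_point C n nu.
Proof.
move=> cs Cc; case: n => [|n] hnu; last first.
  exists (scaled n.+1 nu); first exact/cone_scaled.
  by move=> a; rewrite ffunE mulrC divfK // pnatr_eq0.
(* In degree 0 the exponent can be split off from itself, so minimality makes it zero. *)
exists c => // a; rewrite mul0r.
have [hT ht] := hnu; have [_ hm] := tight_minimal cs hT ht.
rewrite (hm nu) //; first by move: hT; rewrite mul0r.
by rewrite mul0r => z z' _; rewrite !ext_sub !subrr.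
Qed.

(** All conditions compare two coordinates up to an integer, so a monotone map commuting with
    integral translations preserves them; fixing 0 takes care of the value at infinity. *)
Lemma round_cone (g : R -> int) c : {homo g : x y / x <= y} ->
  (forall x (m : int), g (x + m%:~R) = g x + m) -> g 0 = 0 ->
  C c -> cone 1 (fun a => g (c a)).
Proof.
move=> gle gD g0 [h1 h2].
have hE z : ext (fun a => g (c a)) z = g (ext c z) by case: z => //=.
split=> [z z' zz|i si]; rewrite mul1r !hE.
  by rewrite lerBrDl -gD; apply: gle; rewrite -lerBrDl; apply: h1.
by have := h2 _ si => /eqP; rewrite subr_eq => /eqP ->; rewrite [_%:~R + _]addrC gD addrAC subrr add0r.
Qed.

(* Integrality of the polytope: rounding [c] to [floor (c + 1 - u)] keeps it in the
   polytope, and these lattice points differ by the layers of the fractional part. *)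
Lemma lattice_span nu0 (W : {vspace V}) :
  (forall nu, cone 1 nu -> scaled 1 nu - scaled 1 nu0 \in W) ->
  forall c, C c -> c - scaled 1 nu0 \in W.
Proof.
move=> hW c Cc.
pose g (u : R) (x : R) := Num.floor (x + 1 - u).
(* The range of [u] is exactly the condition that [g u] fixes 0. *)
have hg u : 0 < u <= 1 -> cone 1 (fun a => g u (c a)).
  move=> /andP[u0 u1]; apply: round_cone => //.
  - by move=> x y xy; apply: Num.Theory.le_floor; lra.
  - move=> x m; apply: floor_def; rewrite !intrD.
    by have := floor_itv (x + 1 - u); rewrite -/(g u x) intrD; lra.
  - by apply: floor_def; rewrite add0r; lra.
pose f : V := [ffun a => c a - (Num.floor (c a))%:~R].
have fE a : f a = c a - (Num.floor (c a))%:~R by rewrite ffunE.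
have f0 a : 0 <= f a by rewrite fE subr_ge0 Num.Theory.floor_le.
have f1 a : f a < 1 by rewrite fE ltrBlDl; have := floorD1_gt (c a); rewrite intrD.
move: f fE f0 f1 => f fE f0 f1.
pose fl := fun a => Num.floor (c a).
have hfl : cone 1 fl.
  have := hg 1; rewrite (_ : (fun a => g 1 (c a)) = fl); first by apply; rewrite ltr01 lexx.
  by apply/funext => a; rewrite /g addrK.
have fW : f \in W.
  apply: layer_span => // u u0; have [u1|u1] := leP u 1; last first.
    rewrite (_ : [ffun _ => _] = 0) ?mem0v //; apply/ffunP => a; rewrite !ffunE.
    by rewrite leNgt (lt_trans (f1 a)).
  have := hW _ (hg u _); rewrite u0 u1 => /(_ isT) h1; have h2 := hW _ hfl.
  suff -> : [ffun x => ((u <= f x)%R : nat)%:R : R^o]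
     = (scaled 1 (fun a => g u (c a)) - scaled 1 nu0) - (scaled 1 fl - scaled 1 nu0).
    exact: rpredB.
  rewrite opprB addrA subrK; apply/ffunP => a; rewrite !ffunE !divr1.
  rewrite -rmorphB /= /g.
  have -> : Num.floor (c a + 1 - u) = fl a + (u <= f a)%R.
    have := f0 a; have := f1 a; rewrite fE -/(fl a) => h3 h4.
    have e (n : nat) : (n%:Z)%:~R = n%:R :> R by [].
    by apply: floor_def; have [h5|h5] := leP u (c a - (fl a)%:~R); rewrite !intrD e /=; lra.
  by rewrite addrC addKr.
have -> : c - scaled 1 nu0 = f + (scaled 1 fl - scaled 1 nu0).
  by apply/ffunP => a; rewrite !ffunE !divr1 fE addrA subrK.
by rewrite rpredD // hW.
Qed.

(** Serves both dimension bounds: [n] coordinates separate the points of C, and n+1 lattice points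
    are affinely independent in them. Differences of lattice points span the direction space of C,
    so a basis can be taken among them. Column 0 of the matrix consists of ones, the degrees. *)
Lemma polytope_coordinates n : affine_dim C n -> exists J : 'I_n -> P,
  (forall c c', C c -> C c' -> (forall j, c (J j) = c' (J j)) -> c = c') /\
  exists2 v : 'I_n.+1 -> P -> int, forall i, cone 1 (v i)
    & \det (\matrix_(i, j < n.+1) oapp (fun k => v i (J k)) 1 (unlift ord0 j)) != 0.
Proof.
move=> [c0 Cc0 [U [hU Umin Un]]].
have hnu0 : cone 1 (fun a => Num.floor (c0 a)).
  apply: round_cone Cc0; [exact: Num.Theory.le_floor| |exact: Num.Theory.floor0].
  by move=> x m; rewrite floorDrz ?intr_int // intrKfloor.
move: (fun a => _) hnu0 => nu0 hnu0.
pose X : set V := [set scaled 1 nu - scaled 1 nu0 | nu in cone 1].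
have [vs [fvs vsX Xvs]] := free_spanning X.
have spanC c : C c -> c - scaled 1 nu0 \in <<vs>>%VS.
  by apply: lattice_span => nu hnu; apply: Xvs; exists nu.
have UE : <<vs>>%VS = U.
  apply/eqP; rewrite eqEsubv; apply/andP; split.
    apply/span_subvP => v /vsX[nu hnu <-].
    rewrite -(subrKA c0) -[c0 - _]opprB.
    by rewrite rpredB //; apply: hU; apply/cone_scaled.
  apply: Umin => v Cv; rewrite -(subrKA (scaled 1 nu0)) -[_ - c0]opprB.
  by rewrite rpredB // spanC.
have sz : size vs = n by rewrite -(eqP fvs) UE.
move: sz => {Un}; case: _ / => {n}.
(* The rows of [A] are the basis vectors; a nonvanishing maximal minor selects the coordinates. *)
pose n := size vs; pose A : 'M[R]_(n, #|{: P}|) := \matrix_(i, j) (vs`_i) (enum_val j).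
have fA : row_free A.
  apply: inj_row_free => u uA; apply/rowP => i; rewrite mxE.
  have /freeP fr := fvs : free (in_tuple vs).
  apply: (fr (fun i => u 0 i)); apply/ffunP => a; rewrite sum_ffunE ffunE.
  have := congr1 (fun w : 'rV[R]_(#|{: P}|) => w 0 (enum_rank a)) uA.
  rewrite !mxE => h; rewrite -[RHS]h; apply: eq_bigr => j _.
  by rewrite !mxE enum_rankK ffunE.
have fAT : row_full A^T by rewrite /row_full mxrank_tr.
pose f := fullrankfun fAT; pose J (k : 'I_n) : P := enum_val (f k).
pose B : 'M[R]_n := rowsub f A^T.
have Bu : B \in unitmx by exact: fullrowsub_unit.
have BE k i : B k i = vs`_i (J k) by rewrite !mxE.
exists J; split=> [c c' Cc Cc' cc|].
  have cW : c - c' \in <<vs>>%VS.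
    by rewrite -(subrKA (scaled 1 nu0)) -[_ - c']opprB rpredB // spanC.
  pose w : 'cV[R]_n := \col_i coord (in_tuple vs) i (c - c').
  have w0 : w = 0.
    rewrite -[w](mulKmx Bu) (_ : B *m w = 0) ?mulmx0 //; apply/colP => k.
    have := congr1 (fun g : V => g (J k)) (coord_span (cW : c - c' \in <<in_tuple vs>>%VS)).
    rewrite sum_ffunE ffunE [(- c') _]ffunE cc subrr => h; rewrite mxE mxE [RHS]h.
    by apply: eq_bigr => i _; rewrite BE mxE ffunE mulrC.
  apply/eqP; rewrite -subr_eq0 (coord_span (cW : c - c' \in <<in_tuple vs>>%VS)).
  apply/eqP; apply: big1 => i _; have := congr1 (fun g : 'cV[R]_n => g i 0) w0.
  by rewrite !mxE => ->; rewrite scale0r.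
have /choice[nu hnu] : forall k : 'I_n, exists mu,
    cone 1 mu /\ scaled 1 mu - scaled 1 nu0 = vs`_k.
  by move=> k; have /vsX[mu h1 h2] := mem_nth 0 (ltn_ord k); exists mu.
pose v (i : 'I_n.+1) := oapp nu nu0 (unlift ord0 i).
exists v; first by move=> i; rewrite /v; case: unliftP => [k|] _ //=; apply: (hnu k).1.
set M := \matrix_(i, j < _) _.
suff : map_mx (intr : int -> R) M \in unitmx.
  by rewrite unitmxE unitfE det_map_mx intr_eq0.
(* The column of ones forces the kernel vector to have sum zero; subtracting the base point [nu0]
   then leaves a relation killed by the invertible [B]. *)
rewrite -row_free_unit; apply: inj_row_free => u uM.
have h0 : \sum_i u 0 i = 0.
  have := congr1 (fun w : 'rV[R]_n.+1 => w 0 ord0) uM; rewrite !mxE => h.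
  by rewrite -[RHS]h; apply: eq_bigr => i _; rewrite !mxE unlift_none mulr1.
have hk k : \sum_i u 0 i * (v i (J k))%:~R = 0.
  have := congr1 (fun w : 'rV[R]_n.+1 => w 0 (lift ord0 k)) uM; rewrite !mxE => h.
  by rewrite -[RHS]h; apply: eq_bigr => i _; rewrite !mxE liftK.
pose w : 'cV[R]_n := \col_i u 0 (lift ord0 i).
have w0 : w = 0.
  rewrite -[w](mulKmx Bu) (_ : B *m w = 0) ?mulmx0 //; apply/colP => k; rewrite mxE [RHS]mxE.
  have : \sum_i u 0 i * ((v i (J k))%:~R - (nu0 (J k))%:~R) = 0.
    under eq_bigr => i _ do rewrite mulrBr.
    by rewrite sumrB hk -mulr_suml h0 mul0r subr0.
  rewrite big_ord_recl {1}/v unlift_none /= subrr mulr0 add0r => h.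
  rewrite -[RHS]h; apply: eq_bigr => i _.
  by rewrite BE -(hnu i).2 /v liftK /= mxE !ffunE !divr1 mulrC.
apply/rowP => i; rewrite mxE; have hl k : u 0 (lift ord0 k) = 0.
  by have := congr1 (fun g : 'cV[R]_n => g k 0) w0; rewrite !mxE.
case: (unliftP ord0 i) => [k ->|->] //.
by move: h0; rewrite big_ord_recl big1 ?addr0.
Qed.

End Polytope.

(** * The fiber cone *)

Section FiberConeBasis.
Variables (K : fieldType) (d : Order.disp_t) (H : finTBDistrLatticeType d).
Variable (eps : int).
Local Open Scope quotient_scope.
Notation P := (jirr H).
Notation Pp := (pplus H).
Notation L := (ambient K H).
Notation kc := (@lconst K P).
Notation J := (@Kspan K d H (Tset eps)).
Notation F := (fiber_cone J).
Notation pF := (@to_fiber_cone K d H J).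
Implicit Types (e : Pp -> int) (nu : P -> int) (r : seq (K * (Pp -> int))).

(* Bigraded exponents: the value at infinity is the degree in the Rees variable. *)
Definition expo (n : int) nu : Pp -> int := fun z => if z is Some a then nu a else n.
Definition fin_part e : P -> int := fun a => e (Some a).

Lemma expo_fin e : expo (e None) (fin_part e) = e.
Proof. by apply/funext; case. Qed.

Definition valid e : Prop := 0 <= e None /\ Tset (e None * eps) (fin_part e).

Definition mono e : {poly L} := (Tmon K (fin_part e))%:P * 'X^(absz (e None)).

Lemma monoD e1 e2 : valid e1 -> valid e2 ->
  mono (fun z => e1 z + e2 z) = mono e1 * mono e2.
Proof.
move=> [h1 _] [h2 _].
rewrite /mono [RHS]mulrACA -[in RHS]exprD -[in RHS]polyCM -[in RHS]TmonD.
congr (_ * 'X^_).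
by move: (e1 None) (e2 None) h1 h2 => m n; lia.
Qed.

Lemma mono0 : mono (fun=> 0) = 1.
Proof.
have t0 : Tmon K (fin_part (fun=> 0)) = 1 := lmon0 K P.
by rewrite /mono t0 polyC1 mul1r; exact: expr0.
Qed.

Lemma validD e1 e2 : valid e1 -> valid e2 -> valid (fun z => e1 z + e2 z).
Proof.
move=> [h1 t1] [h2 t2]; split; first by rewrite addr_ge0.
by rewrite mulrDl; exact: TsetD.
Qed.

Lemma valid0 : valid (fun=> 0).
Proof. by split=> //; rewrite mul0r; exact: Tset0_0. Qed.

Lemma mono_rees e : valid e -> mono e \in rees_pred J.
Proof.
move=> [h ht]; apply/asboolP => n; rewrite /mono coefCM coefXn.
case: eqVneq => [->|_]; last by rewrite mulr0; case: (submod_idpow J n).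
by rewrite mulr1 idpow_Kspan; apply: Kspan_mon; rewrite gez0_abs.
Qed.

(** Takes the dummy value 0 when the monomial is not in the Rees algebra. *)
Definition rees_mon e : rees J := insubd 0 (mono e).

Lemma val_rees_mon e : valid e -> val (rees_mon e) = mono e.
Proof. by move=> he; rewrite insubdK // mono_rees. Qed.

Lemma const_rees c : (kconst K H c)%:P \in rees_pred J.
Proof.
apply/asboolP => n; rewrite coefC.
case: n => [|n] /=; first by rewrite hibiE; exact: Kspan_const.
by case: (submod_idpow J n.+1).
Qed.

Definition rees_const c : rees J := Rees (const_rees c).

Lemma rees_const_zmod : zmod_morphism rees_const.
Proof. by move=> a b; apply: val_inj; rewrite /= /kconst mpolyCB tofracB polyCB. Qed.

Lemma rees_const_monoid : monoid_morphism rees_const.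
Proof.
split=> [|a b]; apply: val_inj; first by rewrite /= /kconst mpolyC1 tofrac1.
by rewrite /= /kconst mpolyCM tofracM polyCM.
Qed.

HB.instance Definition _ := GRing.isZmodMorphism.Build K (rees J) rees_const rees_const_zmod.
HB.instance Definition _ := GRing.isMonoidMorphism.Build K (rees J) rees_const rees_const_monoid.

Lemma to_fiber_cone_zmod : zmod_morphism pF.
Proof. move=> a b; rewrite /to_fiber_cone; exact: rmorphB. Qed.

Lemma to_fiber_cone_monoid : monoid_morphism pF.
Proof.
split; first exact: (rmorph1 (\pi_({ideal_quot (rees_m_idealr J)}))).
by move=> a b; exact: (rmorphM (\pi_({ideal_quot (rees_m_idealr J)}))).
Qed.

HB.instance Definition _ := GRing.isZmodMorphism.Build (rees J) F pF to_fiber_cone_zmod.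
HB.instance Definition _ := GRing.isMonoidMorphism.Build (rees J) F pF to_fiber_cone_monoid.

Lemma to_fiber_cone_eq0 p : pF p = 0 <-> rees_m p.
Proof.
rewrite -(rmorph0 pF) /to_fiber_cone; split.
  by move/eqP; rewrite -Quotient.idealrBE subr0.
by move=> h; apply/eqP; rewrite -Quotient.idealrBE subr0.
Qed.

Definition mingen e : Prop := 0 <= e None /\ minimal (e None * eps) (fin_part e).

(** Set to 0 off [mingen] so as to be defined on all exponents; on valid ones it is the residue
    class. *)
Definition fiber_mon e : F := if `[< mingen e >] then pF (rees_mon e) else 0.

Definition fiber_const : {rmorphism K -> F} := pF \o rees_const.

Lemma mingen_valid e : mingen e -> valid e.
Proof. by move=> [h [ht _]]. Qed.

Lemma coef_mono_lincomb r n :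
  (\sum_(p <- r) (kc p.1)%:P * mono p.2)`_n =
  lincomb kc (@lmon K P) [seq (p.1, fin_part p.2) | p <- r & absz (p.2 None) == n].
Proof.
rewrite coef_sum /lincomb big_map big_filter [RHS]big_mkcond; apply: eq_bigr => p _.
rewrite coefCM /mono coefCM coefXn eq_sym.
by case: eqP => _; rewrite ?mulr1 // !mulr0.
Qed.

Lemma val_lincomb r : (forall p, p \in r -> valid p.2) ->
  val (lincomb rees_const rees_mon r) = \sum_(p <- r) (kc p.1)%:P * mono p.2.
Proof.
move=> hr; rewrite /lincomb rmorph_sum; apply: eq_big_seq => p /hr hp.
by rewrite rmorphM /= -val_rees_mon.
Qed.

Lemma to_fiber_cone_lincomb r : pF (lincomb rees_const rees_mon r) = lincomb fiber_const (fun e => pF (rees_mon e)) r.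
Proof. by rewrite /lincomb rmorph_sum; apply: eq_bigr => p _; rewrite rmorphM. Qed.

(** A valid exponent that is not minimal is decomposable, so its monomial lies in m J^n and its
    class vanishes. *)
Lemma fiber_mon_valid e : valid e -> fiber_mon e = pF (rees_mon e).
Proof.
move=> hv; rewrite /fiber_mon; case: asboolP => // hg; apply/esym/to_fiber_cone_eq0/asboolP => n.
rewrite val_rees_mon // /mono coefCM coefXn.
case: eqVneq => [->|_]; last by rewrite mulr0; case: (submod_idmul (irrelevant K H) (idpow J n)).
rewrite mulr1 idpow_Kspan idmul_irrelevant; apply: Kspan_mon.
have [h ht] := hv; rewrite gez0_abs //.
by apply: contrapT => nd; apply: hg; split=> //; apply: minimalP.
Qed.

Lemma fiber_mon_nongen e : ~ mingen e -> fiber_mon e = 0.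
Proof. by move=> h; rewrite /fiber_mon asboolF. Qed.

Lemma fiber_mon_mul e1 e2 : mingen e1 -> mingen e2 -> fiber_mon (fun z => e1 z + e2 z) = fiber_mon e1 * fiber_mon e2.
Proof.
move=> /mingen_valid v1 /mingen_valid v2; have v12 := validD v1 v2.
rewrite !fiber_mon_valid // -rmorphM; congr pF; apply: val_inj.
by rewrite rmorphM /= !val_rees_mon // monoD.
Qed.

Lemma mingen0 : mingen (fun=> 0).
Proof.
split=> //; rewrite mul0r; split; first exact: Tset0_0.
move=> eta h0 h1 a; have := Tset0_ge0 a h0; have := Tset0_ge0 a h1.
by rewrite /fin_part; lia.
Qed.

Lemma fiber_mon_0 : fiber_mon (fun=> 0) = 1.
Proof.
rewrite fiber_mon_valid; last exact: valid0.
rewrite -(rmorph1 pF); congr pF; apply: val_inj; rewrite val_rees_mon; last exact: valid0.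
by rewrite mono0 rmorph1.
Qed.

Lemma rees_span (p : rees J) :
  exists2 r, (forall q, q \in r -> valid q.2) & p = lincomb rees_const rees_mon r.
Proof.
have /choice[rr hrr] : forall n : nat, exists r : seq (K * (P -> int)),
    (val p)`_n = lincomb kc (@lmon K P) r /\ forall q, q \in r -> Tset (n%:Z * eps) q.2.
  move=> n; have /asboolP/(_ n) := valP p; rewrite idpow_Kspan => /KspanP[r h1 h2].
  by exists r.
pose r := flatten [seq [seq (q.1, expo n%:Z q.2) | q <- rr n] | n : nat <- iota 0 (size (val p))].
have hr q : q \in r -> valid q.2.
  by move=> /flattenP[_ /mapP[n _ ->] /mapP[q' /(hrr n).2 hq ->]].
exists r => //; apply: val_inj; rewrite val_lincomb //.
rewrite -[LHS]coefK poly_def big_flatten big_map /= -[in RHS](subn0 (size _)) big_mkord.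
apply: eq_bigr => n _; rewrite (hrr n).1 big_map -mul_polyC /lincomb rmorph_sum mulr_suml.
by apply: eq_bigr => q _; rewrite rmorphM -mulrA.
Qed.

Lemma fiber_mon_gen (a : F) : exists r, a = lincomb fiber_const fiber_mon r.
Proof.
have [p ->] : exists p, a = pF p by exists (repr a); rewrite /to_fiber_cone reprK.
have [r hr ->] := rees_span p; exists r; rewrite to_fiber_cone_lincomb.
by apply: eq_lincomb => q /hr hq; rewrite fiber_mon_valid.
Qed.

(** The component in the degree of [e] lies in m J^n, which is spanned by decomposable exponents, so
    a minimal exponent cannot occur with nonzero coefficient. *)
Lemma fiber_mon_indep r e : lincomb fiber_const fiber_mon r = 0 -> mingen e -> lincoef r e = 0.
Proof.
move=> h0 ge.
pose r' := [seq q <- r | `[< mingen q.2 >]].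
have hr' q : q \in r' -> valid q.2.
  by rewrite mem_filter => /andP[/asboolP/mingen_valid].
have : pF (lincomb rees_const rees_mon r') = 0.
  rewrite to_fiber_cone_lincomb -[RHS]h0 /lincomb big_filter big_mkcond; apply: eq_bigr => q _.
  by rewrite /fiber_mon; case: ifP => // _; rewrite mulr0.
move=> /to_fiber_cone_eq0/asboolP/(_ (absz (e None))); have [h hm] := ge.
rewrite idpow_Kspan idmul_irrelevant val_lincomb // coef_mono_lincomb gez0_abs //.
set r2 := [seq _ | _ <- _ & _] => hspan.
have cE : lincoef r2 (fin_part e) = lincoef r e.
  rewrite /lincoef big_map big_filter_cond big_filter_cond; apply: eq_bigl => q /=.
  apply/idP/idP => [/and3P[/asboolP[hq _] /eqP ne /eqP fe]|/eqP ->]; last first.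
    by rewrite !eqxx asboolT.
  apply/eqP; apply: etrans (esym (expo_fin _)) (etrans _ (expo_fin _)).
  by rewrite fe -(gez0_abs hq) ne gez0_abs.
apply/eqP/contraT => ce; have /minimalN[] := hm.
by apply: (Kspan_coef hspan); rewrite cE.
Qed.

Definition graded_cone (s : zseq H) e : Prop :=
  0 <= e None /\ cone eps s (absz (e None)) (fin_part e).

Lemma graded_cone_gen s e : condN s -> graded_cone s e -> mingen e.
Proof.
move=> cs [h [ht hs]]; split=> //; have := tight_minimal cs ht hs.
by rewrite gez0_abs.
Qed.

Lemma graded_cone_valid s e : graded_cone s e -> valid e.
Proof. by move=> [h [ht _]]; split=> //; rewrite -(gez0_abs h). Qed.

Lemma graded_cone0 s : graded_cone s (fun=> 0).
Proof.
split=> //; split; first by rewrite mul0r; exact: Tset0_0.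
by move=> i _; rewrite mul0r; case: (xs s i); case: (ys s i).
Qed.

Lemma graded_coneD s e1 e2 : graded_cone s e1 -> graded_cone s e2 -> graded_cone s (fun z => e1 z + e2 z).
Proof.
move=> [h1 [t1 c1]] [h2 [t2 c2]].
have nD : absz (e1 None + e2 None) = (absz (e1 None) + absz (e2 None))%N.
  by move: (e1 None) (e2 None) h1 h2 => m n; lia.
split; first by rewrite addr_ge0.
split; rewrite nD; first by rewrite PoszD mulrDl; apply: TsetD.
by move=> i si; rewrite PoszD !(ext_add (fin_part e1) (fin_part e2)) mulrDl -(c1 i si) -(c2 i si) opprD addrACA.
Qed.

(** Each tightness equation for a sum adds two inequalities valid for the summands, so equality
    forces both to be tight. *)
Lemma graded_cone_face s : condN s -> face mingen (graded_cone s).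
Proof.
move=> cs; split; [exact: graded_cone0|by move=> e; exact: graded_cone_gen|by move=> e1 e2; exact: graded_coneD|].
move=> e1 e2 [h1 [t1 _]] [h2 [t2 _]] [_ [_ c12]].
have aux (a1 a2 m1 m2 q : int) : m1 * q <= a1 -> m2 * q <= a2 ->
    a1 + a2 = (m1 + m2) * q -> a1 = m1 * q /\ a2 = m2 * q.
  by rewrite mulrDl; lia.
have nD : absz (e1 None + e2 None) = (absz (e1 None) + absz (e2 None))%N.
  by move: (e1 None) (e2 None) h1 h2 => m n; lia.
rewrite -(gez0_abs h1) in t1; rewrite -(gez0_abs h2) in t2.
have both i (si : (i <= size s)%N) := aux _ _ _ _ _
  (Tset_qdist t1 (condN_le cs si)) (Tset_qdist t2 (condN_le cs si)).
by split; split=> //; split=> // i si; have [] // := both i si _;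
  rewrite -PoszD -nD -(c12 i si) !(ext_add (fin_part e1) (fin_part e2)) opprD addrACA.
Qed.

Lemma ehrhart_graded_cone (R : realType) s p : ehrhart K R eps s p ->
  exists2 r, p = \sum_(q <- r) (kc q.1)%:P * mono q.2
    & forall q, q \in r -> graded_cone s q.2.
Proof.
apply: (smallest_sub (X := [set p | exists2 r,
  p = \sum_(q <- r) (kc q.1)%:P * mono q.2 & forall q, q \in r -> graded_cone s q.2])).
  split.
  - move=> c; exists [:: (c, fun=> 0)]; last by move=> q; rewrite inE => /eqP->; apply: graded_cone0.
    by rewrite big_seq1 /= mono0 mulr1.
  - move=> _ _ [r1 -> h1] [r2 -> h2]; exists (r1 ++ lincomb_neg r2).
      rewrite big_cat big_map -sumrN; congr (_ + _).
      by apply: eq_bigr => q _; rewrite rmorphN polyCN mulNr.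
    by move=> q; rewrite mem_cat => /orP[/h1//|/mapP[q' /h2 hq ->]].
  - move=> _ _ [r1 -> h1] [r2 -> h2].
    exists [seq (p.1 * q.1, fun z => p.2 z + q.2 z) | p <- r1, q <- r2]; last first.
      by move=> _ /allpairsP[[p1 p2] /= [/h1 c1 /h2 c2 ->]]; apply: graded_coneD.
    rewrite big_allpairs_dep /= mulr_suml; apply: eq_big_seq => q1 /h1 c1.
    rewrite mulr_sumr; apply: eq_big_seq => q2 /h2 c2.
    by rewrite (monoD (graded_cone_valid c1) (graded_cone_valid c2)) rmorphM polyCM mulrACA.
move=> _ [n [nu [/dilated_cone hn ->]]].
exists [:: (1, expo n nu)]; last by move=> q; rewrite inE => /eqP->; split.
have k1 : kc 1 = 1 := rmorph1 kc.
suff E : \sum_(q <- [:: (1, expo n nu)]) (kc q.1)%:P * mono q.2 = mono (expo n nu).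
  exact (esym E).
by rewrite big_seq1 [fst _]/= [snd _]/= k1 polyC1 mul1r.
Qed.

Lemma lincomb_rees (r : seq (K * (Pp -> int))) (p : rees J) :
  (forall q, q \in r -> valid q.2) ->
  val p = \sum_(q <- r) (kc q.1)%:P * mono q.2 -> p = lincomb rees_const rees_mon r.
Proof. by move=> hr hp; apply: val_inj; rewrite hp val_lincomb. Qed.

(** Exponents in the cone of one sequence are all minimal, so their classes stay independent in the
    fiber cone. *)
Lemma ehrhart_embeds_fiber (R : realType) s : condN s -> ehrhart_embeds R eps J s.
Proof.
move=> cs; split=> [p /ehrhart_graded_cone[r -> hr]|p q].
  by rewrite -val_lincomb; [exact: valP|move=> q /hr/graded_cone_valid].
move=> /ehrhart_graded_cone[r hp hr] /ehrhart_graded_cone[r' hq hr'].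
have vr u : u \in r -> valid u.2 by move=> /hr/graded_cone_valid.
have vr' u : u \in r' -> valid u.2 by move=> /hr'/graded_cone_valid.
rewrite (lincomb_rees vr hp) (lincomb_rees vr' hq) => e.
apply/eqP; rewrite -subr_eq0 -lincomb_opp -lincomb_cat; apply/eqP.
have hc u : u \in r ++ lincomb_neg r' -> graded_cone s u.2.
  by rewrite mem_cat => /orP[/hr//|/mapP[v /hr' hv ->]].
apply: lincomb_cf0 => f /mapP[u ur ->] _; apply: fiber_mon_indep; last exact: graded_cone_gen (hc u ur).
have -> : lincomb fiber_const fiber_mon (r ++ lincomb_neg r') = pF (lincomb rees_const rees_mon (r ++ lincomb_neg r')).
  rewrite to_fiber_cone_lincomb; apply: eq_lincomb => v /hc/graded_cone_valid; exact: fiber_mon_valid.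
by rewrite lincomb_cat lincomb_opp rmorphB; apply/eqP; rewrite subr_eq0; apply/eqP; exact: e.
Qed.

Lemma polytope_nil (R : realType) : exists c, polytope R eps ([::] : zseq H) c.
Proof.
have [nu hT hq] := Tset_depth H eps; exists (scaled R 1 nu); apply/cone_scaled => //.
split; first by rewrite mul1r.
move=> [|//] _; rewrite mul1r hq subr0 //.
Qed.

Lemma Nseq_nil : Nseq eps ([::] : zseq H).
Proof.
by split; first split=> //; [move=> i /=; lia|move=> i j /=; lia|move=> i j /=; lia].
Qed.

Lemma mingen_graded_cone (R : realType) e : mingen e -> exists s,
  [/\ Nseq eps s, exists c, polytope R eps s c & graded_cone s e].
Proof.
(* In degree 0 only the zero exponent is minimal, and it cannot be rescaled to a point of a
   polytope; the empty sequence supplies a nonempty one. *)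
move=> [h hm]; have [e0|e0] := eqVneq (e None) 0.
  exists [::]; split; [exact: Nseq_nil|exact: polytope_nil|].
  have z : e = fun=> 0.
    apply/funext => -[a|]; last exact: e0.
    have [h1 h2] := hm; apply: (h2 (fin_part e)); first by move: h1; rewrite e0 mul0r.
    by move=> z z' _; rewrite e0 mul0r !ext_sub !subrr.
  by rewrite z; apply: graded_cone0.
have [hT h2] := hm; rewrite -(gez0_abs h) in hT h2.
have [s hs ht] := minimal_tight hT h2.
exists s; split=> //; exists (scaled R (absz (e None)) (fin_part e)).
by apply/cone_scaled; [rewrite absz_gt0|split].
Qed.

Lemma fiber_cone_sum (R : realType) :
  [set: F] = sum_family (Nseq eps) (ehrhart_image R eps J).
Proof.
apply/seteqP; split=> // a _; have [r ->] := fiber_mon_gen a.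
have /choice[f hf] : forall e, exists s, Nseq eps s /\
    forall c, ehrhart_image R eps J s (fiber_const c * fiber_mon e).
  move=> e; have [ge|ge] := pselect (mingen e); last first.
    exists [::]; split=> [|c]; first exact: Nseq_nil.
    exists 0; last by rewrite fiber_mon_nongen // mulr0 rmorph0.
    have [h _ _] := subalgebra_alggen (fun c : K => (kconst K H c)%:P)
      [set f | exists n nu, dilated_lattice_point (polytope R eps ([::] : zseq H)) n nu /\
       f = (Tmon K nu)%:P * 'X^n].
    by have := h 0; rewrite -/(rees_const 0) /=; rewrite /kconst mpolyC0 tofrac0 polyC0.
  have [s [hs [c0 hc0] hse]] := mingen_graded_cone R ge; exists s; split=> // c.
  have hv := mingen_valid ge.
  exists (rees_const c * rees_mon e); last by rewrite fiber_mon_valid // rmorphM.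
  have [h _ hM] := subalgebra_alggen (fun c : K => (kconst K H c)%:P)
      [set f | exists n nu, dilated_lattice_point (polytope R eps s) n nu /\
       f = (Tmon K nu)%:P * 'X^n].
  have vE : val (rees_const c * rees_mon e) = (kconst K H c)%:P * mono e.
    by rewrite rmorphM /= val_rees_mon.
  suff : ehrhart K R eps s (val (rees_const c * rees_mon e)) by [].
  rewrite vE; apply: hM; first exact: h.
  move=> S [_]; apply; exists (absz (e None)), (fin_part e); split=> //.
  by apply: cone_dilated hc0 _; [case: hs|case: hse].
exists (size r), (fun i => f (tnth (in_tuple r) i).2),
  (fun i => fiber_const (tnth (in_tuple r) i).1 * fiber_mon (tnth (in_tuple r) i).2).
split; last by rewrite /lincomb big_tnth.
by move=> i; have [] := hf (tnth (in_tuple r) i).2.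
Qed.

Lemma fiber_cone_dim (R : realType) : exists2 n,
  is_max [set e | exists2 s : zseq H, Nseq eps s & affine_dim (polytope R eps s) e] n
  & krull_dim F n.+1.
Proof.
pose D n := `[< exists2 s : zseq H, Nseq eps s & affine_dim (polytope R eps s) n >].
have exD : exists n, D n.
  have [c hc] := polytope_nil R; have [n hn] := affine_dim_ex hc.
  by exists n; apply/asboolP; exists [::] => //; exact: Nseq_nil.
have bD n : D n -> (n <= \dim {:{ffun P -> R^o}})%N.
  by move=> /asboolP[s _]; apply: affine_dim_le.
case: (ex_maxnP exD bD) => n /asboolP[s hs dn] hm; exists n.
  by split; [exists s|move=> m hm'; apply: hm; apply/asboolP].
split.
  have [Jc [_ [v hv hdet]]] := polytope_coordinates dn.
  (* The extra coordinate is infinity, where every [expo 1 (v i)] has value 1: this is the column of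
     ones. *)
  pose Jc' (j : 'I_n.+1) : Pp := omap Jc (unlift ord0 j).
  apply: (@face_chain _ _ _ fiber_const mingen fiber_mon fiber_mon_0 fiber_mon_mul fiber_mon_nongen fiber_mon_gen fiber_mon_indep
    (graded_cone s) n.+1 Jc' (fun i => expo 1 (v i))).
  - by apply: graded_cone_face; case: hs.
  - by move=> i; split=> //; exact: hv.
  - move: hdet; congr (\det _ != 0); apply/matrixP => i j; rewrite !mxE /Jc'.
    by case: (unlift ord0 j).
move=> m p pc.
apply: (@chain_bound _ _ _ fiber_const mingen fiber_mon mingen0 fiber_mon_0 fiber_mon_mul fiber_mon_nongen fiber_mon_gen m p n.+1 pc).
move=> e ge; have [s' [hs' [c hc] hse]] := mingen_graded_cone R ge.
have [n' hn'] := affine_dim_ex hc.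
have [Jc [hJ _]] := polytope_coordinates hn'.
exists (graded_cone s'), n'.+1, (fun j => omap Jc (unlift ord0 j)); split=> //.
- by rewrite ltnS; apply: hm; apply/asboolP; exists s'.
- by apply: graded_cone_face; case: hs'.
move=> e1 e2 h1 h2 he; have cs : condN s' by case: hs'.
have he0 : e1 None = e2 None by have := he ord0; rewrite unlift_none.
have heJ j : e1 (Some (Jc j)) = e2 (Some (Jc j)).
  by have := he (lift ord0 j); rewrite liftK.
(* The two exponents have the same degree. If it is positive, dividing by it gives points of the
   polytope that agree on [Jc], hence are equal; in degree 0 both exponents vanish. *)
have [c1 hc1 d1] := cone_dilated cs hc h1.2.
have [c2 hc2 d2] := cone_dilated cs hc h2.2.
apply/funext => -[a|] //; apply/eqP; rewrite -(eqr_int R); apply/eqP.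
have := d1 a; have := d2 a; rewrite /fin_part => -> ->; rewrite he0.
have [->|n0] := eqVneq (absz (e2 None)) 0%N; first by rewrite !mul0r.
congr (_ * _); congr ((_ : {ffun P -> R^o}) a); apply: hJ => // j.
have := d1 (Jc j); have := d2 (Jc j); rewrite /fin_part heJ he0 => -> /mulfI -> //.
by rewrite pnatr_eq0.
Qed.

End FiberConeBasis.

Theorem theorem5p1 (R : realType) (K : fieldType) (d : Order.disp_t)
    (H : finTBDistrLatticeType d) :
  [/\ (forall s : zseq H, Nseq 1 s -> ehrhart_embeds R 1 (omega K H) s)
        /\ [set: fiber_cone (omega K H)]
           = sum_family (Nseq 1) (ehrhart_image R 1 (omega K H)),
      (forall s : zseq H, Nseq (-1) s ->
         ehrhart_embeds R (-1) (anticanonical K H) s)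
        /\ [set: fiber_cone (anticanonical K H)]
           = sum_family (Nseq (-1))
               (ehrhart_image R (-1) (anticanonical K H)),
      exists2 n, is_max [set e | exists2 s : zseq H, Nseq 1 s
                           & affine_dim (polytope R 1 s) e] n
        & krull_dim (fiber_cone (omega K H)) n.+1
    & exists2 n, is_max [set e | exists2 s : zseq H, Nseq (-1) s
                           & affine_dim (polytope R (-1) s) e] n
        & krull_dim (fiber_cone (anticanonical K H)) n.+1 ].
Proof.
rewrite anticanonicalE; split.
- split; last exact: fiber_cone_sum.
  by move=> s [cs _]; apply: ehrhart_embeds_fiber.
- split; last exact: fiber_cone_sum.
  by move=> s [cs _]; apply: ehrhart_embeds_fiber.
- exact: fiber_cone_dim.
- exact: fiber_cone_dim.
Qed.
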